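(* Let $M$ be a real $n$-dimensional $C^\infty$-manifold, let $S$ be a semispray on $TM$ with local coefficients $G^i(x,y)$, and let $g=(g_{ij}(x,y))$ be a generalized Lagrange metric on $TM$, with inverse matrix $(g^{ij})$. Put $O^{ij}_{kl}=\frac12\left(\delta^i_k\delta^j_l-g^{ij}g_{kl}\right)$ and let $N^c$ be the nonlinear connection (metric with respect to $g$ for $S$) with local coefficients $$N^{ci}_j=\frac12 g^{ik}S(g_{kj})+O^{ik}_{sj}\frac{\partial G^s}{\partial y^k}.$$ Then the family of all nonlinear connections on $TM$ that are metric with respect to $g$ (for the semispray $S$) is given by the nonlinear connections with local coefficients $$N^i_j=N^{ci}_j+O^{ki}_{jm}X^m_k,$$ where $X^m_k$ is an arbitrary $(1,1)$-type d-tensor field. That is, every nonlinear connection of this form is metric, and every metric nonlinear connection is of this form for some $(1,1)$-type d-tensor field $X^m_k$.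
   Context: All objects are $C^\infty$ and the summation convention is used. $(x^i,y^i)$ are the local coordinates on $TM$ induced by local coordinates $(x^i)$ on $M$. The vertical distribution is $V_uTM=\ker(\pi_{*,u})$, $\pi:TM\to M$, spanned by $\partial/\partial y^i$. A d-tensor field is a tensor field on $TM$ described by component functions $(x,y)\mapsto T^{i\ldots}_{j\ldots}(x,y)$ which, under the changes of induced coordinates on $TM$, transform like the components of a tensor field on $M$. A semispray is a vector field $S$ on $TM$ with $JS=\mathbb{C}$, where $J=\frac{\partial}{\partial y^i}\otimes dx^i$ and $\mathbb{C}=y^i\frac{\partial}{\partial y^i}$; locally $S=y^i\frac{\partial}{\partial x^i}-2G^i(x,y)\frac{\partial}{\partial y^i}$, and the $G^i$ are its local coefficients. A nonlinear connection $N$ is an $n$-dimensional distribution $u\mapsto N_uTM$ on $TM$ with $T_uTM=N_uTM\oplus V_uTM$ for all $u$. Its local coefficients $N^i_j(x,y)$ are defined by $\frac{\delta}{\delta x^i}:=h\left(\frac{\partial}{\partial x^i}\right)=\frac{\partial}{\partial x^i}-N^j_i\frac{\partial}{\partial y^j}$, where $h$ is the projector onto $N$ along the vertical distribution. A generalized Lagrange metric is a symmetric d-tensor field with components $g_{ij}(x,y)$ such that the matrix $(g_{ij})$ has rank $n$ everywhere on $TM$. For vertical vector fields put $g(X^i\frac{\partial}{\partial y^i},Y^j\frac{\partial}{\partial y^j})=g_{ij}X^iY^j$. The dynamical covariant derivative of the pair $(S,N)$ is the operator on vertical vector fields $\nabla\left(X^i\frac{\partial}{\partial y^i}\right)=\left(S(X^i)+X^jN^i_j\right)\frac{\partial}{\partial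 y^i}$, extended to $g$ by $(\nabla g)(X,Y)=S(g(X,Y))-g(\nabla X,Y)-g(X,\nabla Y)$ for vertical $X,Y$; locally $(\nabla g)_{ij}=S(g_{ij})-g_{im}N^m_j-g_{mj}N^m_i$. The nonlinear connection $N$ is called metric with respect to $g$ (for $S$) if $\nabla g=0$. *)

(* Defs.v *)
From HB Require Import structures.
From mathcomp Require Import all_boot all_order all_algebra.
From mathcomp Require Import all_classical all_reals.
From mathcomp Require Import topology normedtype derive.
Set Implicit Arguments.
Unset Strict Implicit.
Unset Printing Implicit Defensive.
Import Order.TTheory GRing.Theory Num.Theory.
Import numFieldNormedType.Exports.
Local Open Scope classical_set_scope.
Local Open Scope ring_scope.

(* Meant for finite-dimensional [V] and open [U]: there, [x |-> 'd f x] is of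
   class C^k iff all the maps [x |-> 'd f x v] are. *)
Fixpoint Ck_on (R : realType) (V W : normedModType R) (k : nat) (U : set V)
    (f : V -> W) : Prop :=
  if k is k'.+1 then
    (forall x, U x -> differentiable f x) /\
    (forall v : V, Ck_on k' U (fun x => 'd f x v))
  else forall x, U x -> {for x, continuous f}.

Definition smooth_on (R : realType) (V W : normedModType R) (U : set V)
    (f : V -> W) : Prop := forall k, Ck_on k U f.

(* An atlas on the subset [\bigcup_c chart_dom c] of [T], with model space [V].
   [chart c] and [chart_inv c] are total functions, only meaningful on
   [chart_dom c] and [chart_img c] respectively. *)
Record atlas (R : realType) (V : normedModType R) (T : Type) := Atlas {
  chart_index : Type;
  chart_dom : chart_index -> set T;
  chart : chart_index -> T -> V;
  chart_inv : chart_index -> V -> T }.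

Section AtlasTheory.
Context (R : realType) (V : normedModType R) (T : Type).
Variable A : atlas V T.
Implicit Types (c d : chart_index A) (p q : T).

Definition chart_img c : set V := chart c @` chart_dom c.

Definition overlap c d : set V := chart c @` (chart_dom c `&` chart_dom d).

Definition transition c d : V -> V := chart d \o chart_inv c.

Definition smooth_atlas : Prop :=
  [/\ forall c p, chart_dom c p -> chart_inv c (chart c p) = p,
      forall c d, open (overlap c d) &
      forall c d, smooth_on (overlap c d) (transition c d)].

(* The family of components of a vector in all the charts. *)
Definition components := chart_index A -> V.

(* A tangent vector at [p] is the family of its components in the charts around
   [p], which are related by the differentials of the transition maps. The
   components in the other charts are set to 0, so that two tangent vectors
   are equal iff their components are. *)
Definition tangent_space p : set components := [set v : components |
  (forall c d, chart_dom c p -> chart_dom d p ->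
     v d = 'd (transition c d) (chart c p) (v c)) /\
  (forall c, ~ chart_dom c p -> v c = 0)].

(* The tangent vector at [p] with components [w] in the chart [c]. *)
Definition coord_vector c p (w : V) : components := fun d =>
  if `[< chart_dom c p /\ chart_dom d p >]
  then 'd (transition c d) (chart c p) w else 0.

Definition vector_field (X : T -> components) : Prop :=
  (forall c p, chart_dom c p -> tangent_space p (X p)) /\
  (forall c, smooth_on (chart_img c) (fun z => X (chart_inv c z) c)).

(* [X f] in the chart [c], where [f] is a function of the coordinates. *)
Definition lie_deriv (X : T -> components) c (f : V -> R) (z : V) : R :=
  'd f z (X (chart_inv c z) c).

(* Distributions of rank [k]: locally the span of a smooth frame. *)
Definition distribution k (D : T -> set components) : Prop :=
  forall c p, chart_dom c p ->
  exists (O : set V) (X : 'I_k -> T -> components),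
  [/\ open O, O (chart c p), O `<=` chart_img c,
      forall i, smooth_on O (fun z => X i (chart_inv c z) c) &
      forall z, O z -> let q := chart_inv c z in
      [/\ forall i, tangent_space q (X i q),
          forall a : 'I_k -> R,
            \sum_i a i *: X i q = 0 -> forall i, a i = 0 &
          D q = [set v | exists a : 'I_k -> R, v = \sum_i a i *: X i q]]].

(* The atlas of the tangent bundle, whose points are the pairs [(p, v)] with [v]
   tangent at [p]. The induced coordinates of [(p, v)] are [(x, y)], where [x]
   and [y] are the coordinates of [p] and the components of [v]. *)
Definition tangent_atlas : atlas (V * V)%type (T * components)%type :=
  Atlas (fun c => [set u | chart_dom c u.1 /\ tangent_space u.1 u.2])
        (fun c u => (chart c u.1, u.2 c))
        (fun c z => (chart_inv c z.1, coord_vector c (chart_inv c z.1) z.2)).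

End AtlasTheory.

(* [mfd_atlas] is any atlas of the smooth structure (possibly the maximal
   one). *)
Record manifold (R : realType) (n : nat) := Manifold {
  mfd_point :> topologicalType;
  mfd_atlas : atlas 'rV[R]_n mfd_point;
  mfd_hausdorff : hausdorff_space mfd_point;
  mfd_second_countable : @second_countable mfd_point;
  mfd_cover : \bigcup_c chart_dom (a := mfd_atlas) c = setT;
  mfd_smooth : smooth_atlas mfd_atlas;
  mfd_dom_open : forall c, open (chart_dom (a := mfd_atlas) c);
  mfd_chart_continuous : forall c p, chart_dom (a := mfd_atlas) c p ->
    {for p, continuous (chart (a := mfd_atlas) c)};
  mfd_chart_inv_continuous : forall c x, chart_img (A := mfd_atlas) c x ->
    {for x, continuous (chart_inv (a := mfd_atlas) c)} }.

Section TangentBundle.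
Context (R : realType) (n : nat) (M : manifold R n).

Notation MA := (mfd_atlas M).
Notation TMA := (tangent_atlas MA).
Notation TM := (M * components MA)%type.
Notation E := ('rV[R]_n * 'rV[R]_n)%type.
Notation index := (chart_index TMA).

Implicit Types (c d : index) (u : TM) (z : E) (w : components TMA).

Definition ebasis (i : 'I_n) : 'rV[R]_n := delta_mx 0 i.

(* The coordinate vector field [d/dx^i] on [TM]. *)
Definition ddx c u (i : 'I_n) : components TMA := coord_vector c u (ebasis i, 0).

(* The differential of the projection [(x, y) |-> x]. *)
Definition dproj w : components MA := fun c => (w c).1.

Definition vertical u : set (components TMA) :=
  [set w | tangent_space u w /\ dproj w = 0].

(* [J = d/dy^i (x) dx^i]. *)
Definition almost_tangent w : components TMA := fun c => (0, (w c).1).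

(* [C = y^i d/dy^i]. *)
Definition liouville u : components TMA := fun c => (0, u.2 c).

Definition semispray (S : TM -> components TMA) : Prop :=
  vector_field S /\
  forall c u, chart_dom c u -> almost_tangent (S u) = liouville u.

(* [S = y^i d/dx^i - 2 G^i d/dy^i]. *)
Definition spray_coef (S : TM -> components TMA) c z (i : 'I_n) : R :=
  - 2^-1 * (S (chart_inv c z) c).2 0 i.

(* [T_u TM = N_u (+) V_u]. *)
Definition nonlinear_connection (N : TM -> set (components TMA)) : Prop :=
  distribution n N /\
  forall c u, chart_dom c u ->
    (N u `&` vertical u = [set 0]) /\
    (tangent_space u =
       [set w | exists w1 w2, [/\ N u w1, vertical u w2 & w = w1 + w2]]).

(* The projector [h] onto [N] along the vertical distribution. *)
Definition hproj (N : TM -> set (components TMA)) u w : components TMA :=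
  xget 0 [set w' | N u w' /\ vertical u (w - w')].

(* [conn_coef N c z i j] is [N^i_j], where
   [h (d/dx^j) = d/dx^j - N^i_j d/dy^i]. *)
Definition conn_coef (N : TM -> set (components TMA)) c z (i j : 'I_n) : R :=
  let u := chart_inv c z in - (hproj N u (ddx c u j) c).2 0 i.

(* [dxdx c d z i k] is [dx'^i / dx^k], where [x] and [x'] are the coordinates
   on [M] given by [c] and [d], at the point of coordinates [z] in [c]. *)
Definition dxdx c d z (i k : 'I_n) : R := 'J (transition (A := MA) c d) z.1 k i.

Definition coord_change c d : E -> E := transition (A := TMA) c d.

(* Components [T_ij], with [x'] as above:
   [T_ij = dx'^k/dx^i dx'^l/dx^j T'_kl]. *)
Definition dtensor02 (t : index -> E -> 'M[R]_n) : Prop :=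
  (forall c i j, smooth_on (chart_img c) (fun z => t c z i j)) /\
  (forall c d z, overlap c d z -> forall i j,
     t c z i j = \sum_k \sum_l
       dxdx c d z k i * dxdx c d z l j * t d (coord_change c d z) k l).

(* Components [T^i_j], stored as the entry [(i, j)]:
   [T'^i_j = dx'^i/dx^k dx^l/dx'^j T^k_l]. *)
Definition dtensor11 (t : index -> E -> 'M[R]_n) : Prop :=
  (forall c i j, smooth_on (chart_img c) (fun z => t c z i j)) /\
  (forall c d z, overlap c d z -> forall i j,
     t d (coord_change c d z) i j = \sum_k \sum_l
       dxdx c d z i k * dxdx d c (coord_change c d z) l j * t c z k l).

Definition generalized_lagrange_metric (g : index -> E -> 'M[R]_n) : Prop :=
  [/\ dtensor02 g,
      forall c z, chart_img c z -> forall i j, g c z i j = g c z j i &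
      forall c z, chart_img c z -> \rank (g c z) = n].

(* Here and below, [X : E -> 'rV[R]_n] stands for the vertical vector field
   [X^i d/dy^i] over the domain of the chart [c]. *)
Definition vpair (g : index -> E -> 'M[R]_n) c (X Y : E -> 'rV[R]_n) z : R :=
  \sum_i \sum_j g c z i j * X z 0 i * Y z 0 j.

Definition nabla (S : TM -> components TMA) (N : TM -> set (components TMA)) c
    (X : E -> 'rV[R]_n) z : 'rV[R]_n :=
  \row_i (lie_deriv S c (fun z' => X z' 0 i) z
          + \sum_j X z 0 j * conn_coef N c z i j).

Definition nabla_metric (S : TM -> components TMA)
    (N : TM -> set (components TMA)) (g : index -> E -> 'M[R]_n) c
    (X Y : E -> 'rV[R]_n) z : R :=
  lie_deriv S c (vpair g c X Y) z
  - vpair g c (nabla S N c X) Y z - vpair g c X (nabla S N c Y) z.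

(* [nabla g = 0]; as [nabla] is a local operator, this is tested on the vertical
   vector fields over the chart domains. *)
Definition metric_connection (S : TM -> components TMA)
    (g : index -> E -> 'M[R]_n) (N : TM -> set (components TMA)) : Prop :=
  forall c (X Y : E -> 'rV[R]_n),
    smooth_on (chart_img c) X -> smooth_on (chart_img c) Y ->
    forall z, chart_img c z -> nabla_metric S N g c X Y z = 0.

(* [obata g c z i j k l] is
   [O^{ij}_{kl} = 1/2 (delta^i_k delta^j_l - g^{ij} g_{kl})]. *)
Definition obata (g : index -> E -> 'M[R]_n) c z (i j k l : 'I_n) : R :=
  2^-1 * ((i == k)%:R * (j == l)%:R - invmx (g c z) i j * g c z k l).

(* [N^{ci}_j = 1/2 g^{ik} S(g_{kj}) + O^{ik}_{sj} dG^s/dy^k]. *)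
Definition canonical_coef (S : TM -> components TMA) (g : index -> E -> 'M[R]_n)
    c z (i j : 'I_n) : R :=
  2^-1 * (\sum_k invmx (g c z) i k * lie_deriv S c (fun z' => g c z' k j) z)
  + \sum_k \sum_s obata g c z i k s j
      * 'd (fun z' => spray_coef S c z' s) z (0, ebasis k).

(* [N^i_j = N^{ci}_j + O^{ki}_{jm} X^m_k]. *)
Definition family_coef (S : TM -> components TMA) (g X : index -> E -> 'M[R]_n)
    c z (i j : 'I_n) : R :=
  canonical_coef S g c z i j + \sum_k \sum_m obata g c z k i j m * X c z m k.

Definition has_coef (N : TM -> set (components TMA))
    (B : index -> E -> 'I_n -> 'I_n -> R) : Prop :=
  forall c z, chart_img c z -> forall i j, conn_coef N c z i j = B c z i j.

End TangentBundle.

(* Main.v *)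
Require Import Defs.
From HB Require Import structures.
From mathcomp Require Import all_boot all_order all_algebra perm.
From mathcomp Require Import all_classical all_reals.
From mathcomp Require Import topology normedtype landau derive.
From mathcomp Require Import ring.
Set Implicit Arguments.
Unset Strict Implicit.
Unset Printing Implicit Defensive.
Import Order.TTheory GRing.Theory Num.Theory.
Import numFieldNormedType.Exports.
Local Open Scope classical_set_scope.
Local Open Scope ring_scope.

(** A nonlinear connection amounts to the family, indexed by the charts, of the
    matrices of its local coefficients: these are smooth, and under a change of
    coordinates they obey the inhomogeneous law [connection_family], in which
    the second derivatives of the change, contracted with [y], appear as
    [base_hess]. Given such matrices, the law says that the subspaces of
    equation [w.2 = - w.1 *m b] do not depend on the chart, and they form a
    connection ([family_nonlinear_connection], [family_conn_mx]). Given a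
    connection, its spaces are the graphs of such matrices, which are smooth
    because they are solved for in terms of a smooth frame
    ([nonlinear_connection_family]). Hence the connections form an affine space
    over the d-tensor fields of type (1,1) ([connection_familyD],
    [connection_familyB]).

    The coefficients of [N^c] obey the law. With [C] the transpose of the matrix
    [dG/dy], they are [1/2 (g^-1 S(g) + C^T - g^-1 C g)]. The second derivatives
    enter [dG/dy], because [G] changes by the quadratic map
    [1/2 d^2x'(y, y)], of derivative [d^2x'(y, .)] ([spray_jac_change]), and they
    enter [S(g)], because [S] differentiates the Jacobian matrix in the
    direction [y] ([lie_mx_change]); both facts rest on the symmetry of second
    derivatives ([Schwarz]). The contributions add up to the inhomogeneous term
    of the law ([canonical_of_change], [canonical_connection_family]).

    Finally [nabla g = 0] is, at each point, the affine equation
    [g N + (g N)^T = S(g)] ([metric_connectionP]). It is solved by [N^c]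
    ([canonical_of_metric]), so that the metric connections are the [N^c + X]
    with [g X] skew; and the Obata operator [X |-> 1/2 (X - g^-1 X^T g)] is a
    projector onto the [X] with this property ([obata_of_metric],
    [obata_of_fixed]). For a metric [N], the tensor [X = N - N^c] is thus its own
    image. *)

(** * Functions of class C^k on an open set *)

Section Germs.
Context (R : realType) (V W : normedModType R).
Implicit Types (f g : V -> W) (x : V).

Lemma near_eq_differentiable f g x :
  (\near x, f x = g x) -> differentiable f x -> differentiable g x.
Proof.
move=> fg df.
have dg : g \o shift x = cst (g x) + 'd f x +o_ 0 id.
  rewrite -(nbhs_singleton fg); apply/eqaddoP => e e0.
  have := diff_locally df; move/eqaddoP => /(_ e e0).
  apply: filter_app.
  have : \forall h \near (0 : V), f (h + x) = g (h + x).
    by move: fg; rewrite (near_shift (0 : V)) /= subr0.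
  by apply: filterS => h fgh; rewrite !fctE /= fgh.
apply/diff_locallyP; rewrite (diff_unique _ dg); last exact: diff_continuous.
by split=> //; exact: diff_continuous.
Qed.

Lemma near_eq_diff f g x v :
  (\near x, f x = g x) -> differentiable f x -> 'd g x v = 'd f x v.
Proof.
move=> fg df; rewrite -!deriveE //; last exact: near_eq_differentiable df.
by rewrite (near_eq_derive _ fg).
Qed.

Lemma open_near (U : set V) (P : V -> Prop) x :
  open U -> U x -> (forall y, U y -> P y) -> \near x, P x.
Proof. by move=> oU Ux UP; apply: filterS (open_nbhs_nbhs (conj oU Ux)). Qed.

End Germs.

Section CkRules.
Context (R : realType) (V : normedModType R) (U : set V).
Hypothesis oU : open U.

(** Since [U] is open, the values of [f] off [U] do not matter: a field read in
    a chart can be replaced by any formula valid on the image of the chart. *)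
Lemma Ck_on_congr (W : normedModType R) k (f g : V -> W) :
  (forall x, U x -> f x = g x) -> Ck_on k U f -> Ck_on k U g.
Proof.
elim: k f g => [|k IH] f g fg /=.
  move=> cf x Ux; rewrite -[{for _, _}]/(g @ x --> g x) -fg //.
  apply: cvg_trans (cf x Ux); apply: near_eq_cvg.
  exact: (open_near oU Ux).
move=> [df cf]; split=> [x Ux|v].
  by apply: near_eq_differentiable (df x Ux); apply: (open_near oU Ux).
apply: IH (cf v) => x Ux; apply/esym/near_eq_diff; last exact: df.
exact: (open_near oU Ux).
Qed.

Lemma Ck_on_local (W : normedModType R) k (f : V -> W) :
  (forall x, U x -> exists2 O, O x & Ck_on k O f) -> Ck_on k U f.
Proof.
elim: k f => [|k IH] f H /=; first by move=> x /H[B Bx]; apply.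
split=> [x /H[B Bx [df _]]|v]; first exact: df.
by apply: IH => x /H[B Bx [_ /(_ v) ?]]; exists B.
Qed.

Lemma Ck_on_differentiable (W : normedModType R) (f : V -> W) :
  (forall x, U x -> differentiable f x) -> Ck_on 0 U f.
Proof. by move=> df x Ux; apply/differentiable_continuous/df. Qed.

Lemma Ck_onW (W : normedModType R) k (f : V -> W) :
  Ck_on k.+1 U f -> Ck_on k U f.
Proof.
elim: k f => [f [df _]|k IH f [df cf]]; first exact: Ck_on_differentiable.
by split=> // v; apply: IH.
Qed.

Lemma Ck_on_cst (W : normedModType R) k (a : W) : Ck_on k U (cst a).
Proof.
elim: k a => [|k IH] a; first by move=> x _; apply: cst_continuous.
split=> [x _|v]; first exact: differentiable_cst.
by apply: (Ck_on_congr _ (IH 0)) => x _; rewrite diff_cst.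
Qed.

Lemma Ck_on_lin (W W' : normedModType R) (L : {linear W -> W'}) k (f : V -> W) :
  continuous L -> Ck_on k U f -> Ck_on k U (L \o f).
Proof.
move=> cL; elim: k f => [|k IH] f.
  by move=> cf x Ux; apply: continuous_comp; [exact: cf|exact: cL].
have dL x : differentiable L x by apply: linear_differentiable.
move=> [df cf]; split=> [x Ux|v]; first exact: differentiable_comp (df x Ux) _.
apply: (Ck_on_congr _ (IH _ (cf v))) => x Ux /=.
by rewrite (diff_comp (df x Ux) (dL _)) /= (diff_lin _ cL).
Qed.

Lemma Ck_onD (W : normedModType R) k (f g : V -> W) :
  Ck_on k U f -> Ck_on k U g -> Ck_on k U (fun x => f x + g x).
Proof.
elim: k f g => [|k IH] f g.
  by move=> cf cg x Ux; apply: continuousD; [exact: cf|exact: cg].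
move=> [df cf] [dg cg]; split=> [x Ux|v].
  by apply: differentiableD; [exact: df|exact: dg].
apply: (Ck_on_congr _ (IH _ _ (cf v) (cg v))) => x Ux /=.
by rewrite diffD //; [exact: df|exact: dg].
Qed.

Lemma Ck_onM k (f g : V -> R) :
  Ck_on k U f -> Ck_on k U g -> Ck_on k U (fun x => f x * g x).
Proof.
elim: k f g => [|k IH] f g.
  by move=> cf cg x Ux; apply: continuousM; [exact: cf|exact: cg].
move=> Cf Cg; have [df cf] := Cf; have [dg cg] := Cg; split=> [x Ux|v].
  by apply: differentiableM; [exact: df|exact: dg].
apply: (Ck_on_congr _ (Ck_onD (IH _ _ (Ck_onW Cf) (cg v))
                              (IH _ _ (Ck_onW Cg) (cf v)))) => x Ux /=.
by rewrite diffM //; [exact: df|exact: dg].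
Qed.

(** By induction on [k], as [d(1/f) = - (1/f)^2 df] involves [1/f] itself with
    one derivative less. *)
Lemma Ck_onV k (f : V -> R) : (forall x, U x -> f x != 0) ->
  Ck_on k U f -> Ck_on k U (fun x => (f x)^-1).
Proof.
move=> f0; elim: k => [|k IH].
  by move=> cf x Ux; apply: continuousV; [exact: f0|exact: cf].
move=> Cf; have [df cf] := Cf; have CV := IH (Ck_onW Cf); split=> [x Ux|v].
  by apply: differentiableV; [exact: df|exact: f0].
have C := Ck_onM (Ck_onM (Ck_on_cst k (-1 : R)) (Ck_onM CV CV)) (cf v).
apply: Ck_on_congr C => x Ux.
rewrite diffV; [|exact: df|exact: f0].
by rewrite /= mulN1r -invfM -expr2.
Qed.

Lemma Ck_onZl (W : normedModType R) k (f : V -> R) (w : W) :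
  Ck_on k U f -> Ck_on k U (fun x => f x *: w).
Proof.
elim: k f => [|k IH] f.
  by move=> cf x Ux; apply: continuousZr_tmp; exact: cf.
move=> [df cf]; split=> [x Ux|v]; first by apply/differentiableZl/df.
apply: (Ck_on_congr _ (IH _ (cf v))) => x Ux /=.
by rewrite diffZl //; exact: df.
Qed.

End CkRules.

(** * Smooth functions and matrices *)

Section SmoothMatrices.
Context (R : realType) (V : normedModType R) (U : set V).
Hypothesis oU : open U.

Lemma smooth_on_diff (W : normedModType R) (f : V -> W) :
  smooth_on U f -> forall x, U x -> differentiable f x.
Proof. by move=> /(_ 1%N)[]. Qed.

Lemma smooth_on_deriv (W : normedModType R) (f : V -> W) v :
  smooth_on U f -> smooth_on U (fun x => 'd f x v).
Proof. by move=> sf k; have [_ /(_ v)] := sf k.+1. Qed.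

Lemma smooth_on_sum (W : normedModType R) (I : Type) (r : seq I) (P : pred I)
    (f : I -> V -> W) : (forall i, P i -> smooth_on U (f i)) ->
  smooth_on U (fun x => \sum_(i <- r | P i) f i x).
Proof.
move=> sf k; elim: r => [|i r IH].
  by apply: (Ck_on_congr oU _ (Ck_on_cst oU k 0)) => x _; rewrite big_nil.
case Pi: (P i); last first.
  by apply: (Ck_on_congr oU _ IH) => x _; rewrite big_cons Pi.
by apply: (Ck_on_congr oU _ (Ck_onD oU (sf i Pi k) IH)) => x _; rewrite big_cons Pi.
Qed.

Lemma smooth_on_prod (I : Type) (r : seq I) (P : pred I) (f : I -> V -> R) :
  (forall i, P i -> smooth_on U (f i)) ->
  smooth_on U (fun x => \prod_(i <- r | P i) f i x).
Proof.
move=> sf k; elim: r => [|i r IH].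
  by apply: (Ck_on_congr oU _ (Ck_on_cst oU k (1 : R))) => x _; rewrite big_nil.
case Pi: (P i); last first.
  by apply: (Ck_on_congr oU _ IH) => x _; rewrite big_cons Pi.
by apply: (Ck_on_congr oU _ (Ck_onM oU (sf i Pi k) IH)) => x _; rewrite big_cons Pi.
Qed.

Definition smooth_mx m n (F : V -> 'M[R]_(m, n)) :=
  forall i j, smooth_on U (fun x => F x i j).

Lemma smooth_mx_congr m n (F G : V -> 'M[R]_(m, n)) :
  (forall x, U x -> F x = G x) -> smooth_mx F -> smooth_mx G.
Proof.
by move=> FG sF i j k; apply: Ck_on_congr (sF i j k) => // x /FG ->.
Qed.

Lemma smooth_mx_tr m n (F : V -> 'M[R]_(m, n)) :
  smooth_mx F -> smooth_mx (fun x => (F x)^T).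
Proof.
by move=> sF i j k; apply: Ck_on_congr (sF j i k) => // x _; rewrite mxE.
Qed.

Lemma smooth_mxD m n (F G : V -> 'M[R]_(m, n)) :
  smooth_mx F -> smooth_mx G -> smooth_mx (fun x => F x + G x).
Proof.
move=> sF sG i j k.
by apply: Ck_on_congr (Ck_onD oU (sF i j k) (sG i j k)) => // x _; rewrite mxE.
Qed.

Lemma smooth_mxZ m n (a : R) (F : V -> 'M[R]_(m, n)) :
  smooth_mx F -> smooth_mx (fun x => a *: F x).
Proof.
move=> sF i j k; have C := Ck_onM oU (Ck_on_cst oU k a) (sF i j k).
by apply: Ck_on_congr C => // x _; rewrite mxE.
Qed.

Lemma smooth_mxN m n (F : V -> 'M[R]_(m, n)) :
  smooth_mx F -> smooth_mx (fun x => - F x).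
Proof.
by move=> /(smooth_mxZ (-1)); apply: smooth_mx_congr => x _; rewrite scaleN1r.
Qed.

Lemma smooth_mxM m n p (F : V -> 'M[R]_(m, n)) (G : V -> 'M[R]_(n, p)) :
  smooth_mx F -> smooth_mx G -> smooth_mx (fun x => F x *m G x).
Proof.
move=> sF sG i j.
have C : smooth_on U (fun x => \sum_h F x i h * G x h j).
  by apply: smooth_on_sum => h _ k; apply: Ck_onM; [|exact: sF|exact: sG].
by move=> k; apply: Ck_on_congr (C k) => // x _; rewrite mxE.
Qed.

Lemma smooth_det n (F : V -> 'M[R]_n) :
  smooth_mx F -> smooth_on U (fun x => \det (F x)).
Proof.
move=> sF; apply: smooth_on_sum => s _ k.
have sp : smooth_on U (fun x => \prod_i F x i (s i)).
  by apply: smooth_on_prod => i _; exact: sF.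
by apply: Ck_on_congr (Ck_onM oU (Ck_on_cst oU k ((-1) ^+ s : R)) (sp k)).
Qed.

(** By Cramer's rule, the entries are quotients of polynomials in those of [F x]
    by the determinant. *)
Lemma smooth_invmx n (F : V -> 'M[R]_n) : (forall x, U x -> F x \in unitmx) ->
  smooth_mx F -> smooth_mx (fun x => invmx (F x)).
Proof.
move=> uF sF i j k.
have dF0 x : U x -> \det (F x) != 0 by move=> /uF; rewrite unitmxE unitfE.
have C : Ck_on k U (fun x => cofactor (F x) j i).
  have sm : smooth_mx (fun x => row' j (col' i (F x))).
    move=> a b l; apply: Ck_on_congr (sF (lift j a) (lift i b) l) => // x _.
    by rewrite !mxE.
  have sgn := Ck_on_cst oU k ((-1) ^+ (j + i) : R).
  by apply: Ck_on_congr (Ck_onM oU sgn (smooth_det sm k)).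
have D := Ck_onV oU dF0 (smooth_det sF k).
apply: Ck_on_congr (Ck_onM oU D C) => // x Ux.
by rewrite /invmx uF // !mxE.
Qed.

Lemma smooth_on_rV n (f : V -> 'rV[R]_n) : smooth_on U f -> smooth_mx f.
Proof.
move=> sf i j k; pose c (N : 'rV[R]_n) : R := N i j.
have lc : linear c by move=> a u v; rewrite /c !mxE.
pose cL := GRing.isLinear.Build _ _ _ _ _ lc.
pose L : {linear 'rV[R]_n -> R} := HB.pack c cL.
by apply: (@Ck_on_lin _ _ _ oU _ _ L); [exact: coord_continuous|exact: sf].
Qed.

Lemma smooth_on_fst (W W' : normedModType R) (f : V -> W * W') :
  smooth_on U f -> smooth_on U (fun x => (f x).1).
Proof.
have c : continuous (fst : {linear (W * W')%type -> W}) by move=> x; exact: cvg_fst.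
by move=> sf k; have := Ck_on_lin oU c (sf k).
Qed.

Lemma smooth_on_snd (W W' : normedModType R) (f : V -> W * W') :
  smooth_on U f -> smooth_on U (fun x => (f x).2).
Proof.
have c : continuous (snd : {linear (W * W')%type -> W'}) by move=> x; exact: cvg_snd.
by move=> sf k; have := Ck_on_lin oU c (sf k).
Qed.

End SmoothMatrices.

Section DirectionalDerivative.
Context (R : realType) (n : nat).
Notation E := ('rV[R]_n * 'rV[R]_n)%type.

Lemma sum_pair_scale k (a : 'I_k -> R) (v1 v2 : 'I_k -> 'rV[R]_n) :
  \sum_i a i *: ((v1 i, v2 i) : E) = (\sum_i a i *: v1 i, \sum_i a i *: v2 i).
Proof.
rewrite [LHS]surjective_pairing; congr pair.
  by rewrite (raddf_sum (fst : {additive E -> 'rV[R]_n})).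
by rewrite (raddf_sum (snd : {additive E -> 'rV[R]_n})).
Qed.

Lemma pair_sum_basis (v : E) :
  v = \sum_i (v.1 0 i *: (ebasis R i, 0) + v.2 0 i *: (0, ebasis R i)).
Proof.
rewrite [LHS]surjective_pairing [RHS]surjective_pairing; congr pair.
  rewrite (raddf_sum (fst : {additive E -> 'rV[R]_n})) {1}[v.1]row_sum_delta.
  by apply: eq_bigr => i _; rewrite /= scaler0 addr0.
rewrite (raddf_sum (snd : {additive E -> 'rV[R]_n})) {1}[v.2]row_sum_delta.
by apply: eq_bigr => i _; rewrite /= scaler0 add0r.
Qed.

Variable U : set E.
Hypothesis oU : open U.

(** Smoothness bears on the derivatives along fixed vectors; the derivative along
    a field is their combination with the components of the field. *)
Lemma smooth_on_dirderiv (f : E -> R) (w : E -> E) :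
  smooth_on U f -> smooth_on U w -> smooth_on U (fun z => 'd f z (w z)).
Proof.
move=> sf sw.
have s1 := smooth_on_rV oU (smooth_on_fst oU sw).
have s2 := smooth_on_rV oU (smooth_on_snd oU sw).
have C : smooth_on U (fun z => \sum_i ((w z).1 0 i * 'd f z (ebasis R i, 0)
                                    + (w z).2 0 i * 'd f z (0, ebasis R i))).
  apply: smooth_on_sum => // i _ k; apply: Ck_onD => //; apply: Ck_onM => //.
  - exact: s1.
  - exact: smooth_on_deriv.
  - exact: s2.
  - exact: smooth_on_deriv.
move=> k; apply: Ck_on_congr (C k) => // z _.
rewrite [w z in RHS]pair_sum_basis linear_sum; apply: eq_bigr => i _.
by rewrite linearD !linearZ.
Qed.

End DirectionalDerivative.

(** * Symmetry of the second derivatives *)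

Section Schwarz.
Context (R : realType) (V : normedModType R).

Let diff_line (f : V -> R) (x v : V) (t : R) :
  differentiable f (x + t *: v) ->
  is_derive t 1 (fun s => f (x + s *: v)) ('d f (x + t *: v) v).
Proof.
move=> df.
have dl : is_diff t (fun s : R => x + s *: v) ( *:%R^~ v).
  apply: is_diff_eq (is_diffD (is_diff_cst x t) (is_diff_scalel t v)) _.
  by rewrite add0r.
have dc := is_diff_comp dl (differentiableP df).
have [dfl dfE] := dc; apply: DeriveDef; first exact: diff_derivable.
by rewrite deriveE // dfE /= scale1r.
Qed.

Let mvt_line (f : V -> R) (x v : V) (h : R) : 0 <= h ->
  (forall t, 0 <= t <= h -> differentiable f (x + t *: v)) ->
  exists2 t, 0 <= t <= h & f (x + h *: v) - f x = h * 'd f (x + t *: v) v.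
Proof.
move=> h0 df.
have [||t] := @MVT_segment R (fun s => f (x + s *: v))
    (fun s => 'd f (x + s *: v) v) 0 h h0.
- move=> t; rewrite in_itv /= => /andP[t0 th].
  by apply: diff_line; apply: df; rewrite !ltW.
- apply: derivable_within_continuous => t; rewrite in_itv /= => th.
  by have [] := diff_line (df t th).
- rewrite in_itv /= => th E; exists t => //.
  by move: E; rewrite scale0r addr0 subr0 mulrC.
Qed.

(* The mean value theorem for [y |-> f (y + h *: w) - f y] along [v], then for
   [y |-> 'd f y v] along [w]. *)
Let second_difference (U : set V) (f : V -> R) (x v w : V) (h : R) : 0 <= h ->
  (forall s t, 0 <= s <= h -> 0 <= t <= h -> U (x + s *: v + t *: w)) ->
  Ck_on 2 U f ->
  exists s t, [/\ 0 <= s <= h, 0 <= t <= h &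
    f (x + h *: v + h *: w) - f (x + h *: v) - f (x + h *: w) + f x =
    h * (h * 'd (fun y => 'd f y v) (x + s *: v + t *: w) w)].
Proof.
move=> h0 UP [df /(_ v) [ddf _]].
have hh : 0 <= h <= h by rewrite h0 lexx.
have h00 : 0 <= (0 : R) <= h by rewrite lexx.
pose g y := f (y + h *: w) - f y.
have dg s : 0 <= s <= h -> is_diff (x + s *: v) g
    (('d f (x + s *: v + h *: w) : V -> R) - ('d f (x + s *: v) : V -> R)).
  move=> sh.
  have tr : is_diff (x + s *: v) (fun y : V => y + h *: w) id.
    apply: is_diff_eq (is_diffD (is_diff_id _) (is_diff_cst (h *: w) _)) _.
    by rewrite addr0.
  have d1 : differentiable f (x + s *: v + h *: w) by apply/df/UP.
  have d2 : differentiable f (x + s *: v).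
    by have := df _ (UP _ _ sh h00); rewrite scale0r addr0.
  exact: is_diffB (is_diff_comp tr (differentiableP d1)) (differentiableP d2).
have [s sh Es] : exists2 s, 0 <= s <= h &
    g (x + h *: v) - g x = h * 'd g (x + s *: v) v.
  by apply: mvt_line => // s /dg[].
have [t th Et] := @mvt_line (fun y => 'd f y v) (x + s *: v) w h h0
  (fun t th => ddf _ (UP _ _ sh th)).
exists s, t; split=> //; rewrite -Et.
have [_ /(congr1 (fun F => F v)) Eg] := dg s sh.
move: Es; rewrite Eg /g /= => <-.
by rewrite opprB addrA addrAC.
Qed.

(** The second difference of [f] along [v] and [w] does not depend on the order
    of [v] and [w], and once divided by [h ^ 2] it is a value, close to [x], of
    either mixed derivative. *)
Lemma Schwarz (U : set V) (f : V -> R) (x v w : V) : open U -> U x ->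
  Ck_on 2 U f ->
  'd (fun y => 'd f y v) x w = 'd (fun y => 'd f y w) x v.
Proof.
move=> oU Ux Cf; have [_ C1] := Cf.
have [_ /(_ w x Ux) ca] := C1 v; have [_ /(_ v x Ux) cb] := C1 w.
set a := fun y => 'd (fun y => 'd f y v) y w in ca *.
set b := fun y => 'd (fun y => 'd f y w) y v in cb *.
apply/eqP; rewrite -[_ == _]/(a x == b x) -subr_eq0 -normr_le0 leNgt.
apply/negP => ab0; pose e := `|a x - b x| / 2.
have e0 : 0 < e by rewrite divr_gt0.
have : \forall y \near x, [/\ U y, `|a x - a y| < e & `|b x - b y| < e].
  have nU : \forall y \near x, U y by exact: open_nbhs_nbhs.
  have na : \forall y \near x, `|a x - a y| < e by move/cvgrPdist_lt : ca; apply.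
  have nb : \forall y \near x, `|b x - b y| < e by move/cvgrPdist_lt : cb; apply.
  by near=> y; split; near: y.
move=> /nbhs_ballP[r /= r0 rP].
(* The term [1] covers the case where [v] and [w] both vanish. *)
pose m := `|v| + `|w| + 1; have m0 : 0 < m by rewrite ltr_wpDl ?addr_ge0.
pose h := r / m; have h0 : 0 < h by rewrite divr_gt0.
have P s t : 0 <= s <= h -> 0 <= t <= h -> ball x r (x + s *: v + t *: w).
  move=> /andP[s0 sh] /andP[t0 th]; rewrite -ball_normE /= -addrA opprD addNKr normrN.
  rewrite (le_lt_trans (ler_normD _ _)) // !normrZ !ger0_norm //.
  have -> : r = h * m by rewrite /h divfK // gt_eqF.
  rewrite (@le_lt_trans _ _ (h * `|v| + h * `|w|)) //.
    by rewrite lerD // ler_wpM2r.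
  by rewrite -mulrDr ltr_pM2l // ltrDl.
have P' s t : 0 <= s <= h -> 0 <= t <= h -> ball x r (x + s *: w + t *: v).
  by move=> sh th; rewrite addrAC; exact: P.
have [s [t [sh th E]]] := @second_difference U f x v w h (ltW h0)
  (fun s t sh th => let: And3 Uy _ _ := rP _ (P s t sh th) in Uy) Cf.
have [s' [t' [sh' th' E']]] := @second_difference U f x w v h (ltW h0)
  (fun s t sh th => let: And3 Uy _ _ := rP _ (P' s t sh th) in Uy) Cf.
have : h * (h * a (x + s *: v + t *: w)) = h * (h * b (x + s' *: w + t' *: v)).
  rewrite -[LHS]E -[RHS]E' (addrAC x (h *: w)).
  by congr (_ + _); exact: addrAC.
have hu : h != 0 by rewrite gt_eqF.
move=> /(mulfI hu) /(mulfI hu) Eab.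
have [_ pa _] := rP _ (P s t sh th); have [_ _ qb] := rP _ (P' s' t' sh' th').
have : `|a x - b x| < e + e.
  rewrite -[a x](subrK (a (x + s *: v + t *: w))) {2}Eab -addrA.
  by rewrite (le_lt_trans (ler_normD _ _)) // ltrD // distrC.
by rewrite -splitr ltxx.
Unshelve. all: by end_near. Qed.

End Schwarz.

Lemma diff_compE (R : realType) (U V W : normedModType R) (f : U -> V)
    (g : V -> W) x v : differentiable f x -> differentiable g (f x) ->
  'd (g \o f) x v = 'd g (f x) ('d f x v).
Proof. by move=> df dg; rewrite (diff_comp df dg). Qed.

Section RowValued.
Context (R : realType) (V : normedModType R) (n : nat).

Lemma diff_coord (f : V -> 'rV[R]_n) x v i : differentiable f x ->
  differentiable (fun y => f y 0 i) x /\
  'd (fun y => f y 0 i) x v = ('d f x v) 0 i.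
Proof.
move=> df; pose c (N : 'rV[R]_n) : R := N 0 i.
have lc : linear c by move=> a u w; rewrite /c !mxE.
pose cL := GRing.isLinear.Build _ _ _ _ _ lc.
pose L : {linear 'rV[R]_n -> R} := HB.pack c cL.
have cc : continuous L by exact: coord_continuous.
have dL : differentiable L (f x) by exact: linear_differentiable.
split; first exact: differentiable_comp df dL.
by rewrite (diff_comp df dL) -[LHS]/('d L (f x) ('d f x v)) (diff_lin _ cc).
Qed.

Lemma Schwarz_rV (U : set V) (f : V -> 'rV[R]_n) (x v w : V) :
  open U -> U x -> smooth_on U f ->
  'd (fun y => 'd f y v) x w = 'd (fun y => 'd f y w) x v.
Proof.
move=> oU Ux sf; apply/rowP => i.
have df y : U y -> differentiable f y by exact: smooth_on_diff.
have dd u : differentiable (fun y => 'd f y u) x.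
  by apply: (smooth_on_diff _ Ux); exact: smooth_on_deriv.
have E u u' : ('d (fun y => 'd f y u) x u') 0 i =
    'd (fun y => 'd (fun z => f z 0 i) y u) x u'.
  have [dc <-] := diff_coord u' i (dd u).
  apply/esym/near_eq_diff => //; apply: (open_near oU Ux) => y Uy.
  by have [_ ->] := diff_coord u i (df y Uy).
rewrite !E; apply: (Schwarz _ _ oU Ux).
by have C := smooth_on_rV oU sf; exact: C.
Qed.

End RowValued.

(** * Tangent spaces of an atlas *)

Section DifferentiableAtlas.
Context (R : realType) (V : normedModType R) (T : Type).
Variable A : atlas V T.
Implicit Types (c d e : chart_index A) (p : T).

(** The part of smoothness on which the calculus of tangent vectors rests. It
    passes to the tangent atlas by the chain rule of first order. *)
Definition diff_atlas : Prop :=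
  [/\ forall c p, chart_dom c p -> chart_inv c (chart c p) = p,
      forall c d, open (overlap c d) &
      forall c d z, overlap c d z -> differentiable (transition c d) z].

Hypothesis HA : diff_atlas.

Lemma chartK c p : chart_dom c p -> chart_inv c (chart c p) = p.
Proof. by have [H _ _] := HA; exact: H. Qed.

Lemma overlap_open c d : open (overlap c d).
Proof. by have [_ + _] := HA; apply. Qed.

Lemma diff_transition c d z :
  overlap c d z -> differentiable (transition c d) z.
Proof. by have [_ _] := HA; apply. Qed.

Lemma overlap_chart c d p :
  chart_dom c p -> chart_dom d p -> overlap c d (chart c p).
Proof. by move=> cp dp; exists p. Qed.

Lemma overlapP c d z : overlap c d z ->
  [/\ chart_dom c (chart_inv c z), chart_dom d (chart_inv c z) &
      chart c (chart_inv c z) = z].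
Proof. by move=> [p [cp dp] <-]; rewrite chartK. Qed.

Lemma chart_img_overlap c : chart_img c = overlap c c.
Proof. by rewrite /overlap setIid. Qed.

Lemma chart_img_open c : open (chart_img c).
Proof. by rewrite chart_img_overlap; exact: overlap_open. Qed.

Lemma chart_imgP c z : chart_img c z ->
  chart_dom c (chart_inv c z) /\ chart c (chart_inv c z) = z.
Proof. by rewrite chart_img_overlap => /overlapP[]. Qed.

Lemma chart_img_chart c p : chart_dom c p -> chart_img c (chart c p).
Proof. by move=> cp; exists p. Qed.

Lemma transition_chart c d p :
  chart_dom c p -> transition c d (chart c p) = chart d p.
Proof. by move=> cp; rewrite /transition /= chartK. Qed.

Lemma transition_inv c d z :
  overlap c d z -> chart_inv d (transition c d z) = chart_inv c z.
Proof. by move=> /overlapP[_ dz _]; rewrite /transition /= chartK. Qed.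

Lemma overlap_transition c d z :
  overlap c d z -> overlap d c (transition c d z).
Proof. by move=> /overlapP[cz dz _]; exact: overlap_chart. Qed.

Lemma diff_transition_id c z v : chart_img c z -> 'd (transition c c) z v = v.
Proof.
move=> cz; rewrite (@near_eq_diff _ _ _ id) ?diff_val //.
apply: (open_near (chart_img_open c) cz) => y /chart_imgP[_ yE].
by rewrite /transition /= yE.
Qed.

(** The chain rule, read on germs because [transition d e \o transition c d]
    and [transition c e] only agree where the three charts meet. *)
Lemma diff_transition_comp c d e p v :
  chart_dom c p -> chart_dom d p -> chart_dom e p ->
  'd (transition d e) (chart d p) ('d (transition c d) (chart c p) v) =
  'd (transition c e) (chart c p) v.
Proof.
move=> cp dp ep.
have d1 := diff_transition (overlap_chart cp dp).
have d2 := diff_transition (overlap_chart dp ep).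
rewrite -(transition_chart d cp) in d2 *.
have -> : 'd (transition c e) (chart c p) v =
    'd (transition d e \o transition c d) (chart c p) v.
  apply: near_eq_diff; last exact: differentiable_comp.
  have oO := openI (overlap_open c d) (overlap_open c e).
  apply: (open_near oO) => [|z [cdz cez]]; first by split; exact: overlap_chart.
  by rewrite /= {1}/transition /= transition_inv.
by rewrite diff_compE.
Qed.

Lemma coord_vector_self c p w : chart_dom c p -> coord_vector c p w c = w.
Proof.
move=> cp; rewrite /coord_vector asboolT //.
by rewrite diff_transition_id //; exact: chart_img_chart.
Qed.

Lemma coord_vectorE c d p w : chart_dom c p -> chart_dom d p ->
  coord_vector c p w d = 'd (transition c d) (chart c p) w.
Proof. by move=> cp dp; rewrite /coord_vector asboolT. Qed.

Lemma coord_vector_tangent c p w :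
  chart_dom c p -> tangent_space p (coord_vector c p w).
Proof.
move=> cp; split=> [d e dp ep|d dp]; last by rewrite /coord_vector asboolF // => -[].
by rewrite !coord_vectorE // diff_transition_comp.
Qed.

Lemma tangent_coordK c p v :
  chart_dom c p -> tangent_space p v -> coord_vector c p (v c) = v.
Proof.
move=> cp [vE v0]; apply/funext => d; rewrite /coord_vector.
by case: asboolP => [[_ dp]|dp]; [rewrite -vE|rewrite v0 // => dp'; apply: dp].
Qed.

Lemma tangent_eq c p v w : chart_dom c p -> tangent_space p v ->
  tangent_space p w -> v c = w c -> v = w.
Proof.
by move=> cp tv tw vw; rewrite -(tangent_coordK cp tv) vw tangent_coordK.
Qed.

Lemma tangent_space_lin (a : R) p (v w : components A) :
  tangent_space p v -> tangent_space p w -> tangent_space p (a *: v + w).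
Proof.
move=> [vE v0] [wE w0]; split=> [c d cp dp|c cp].
  by rewrite !fctE (vE c d cp dp) (wE c d cp dp) linearP.
by rewrite !fctE v0 // w0 // scaler0 addr0.
Qed.

Lemma tangent_space0 p : tangent_space (A := A) p 0.
Proof. by split=> // c d _ _; exact/esym/linear0. Qed.

Lemma tangent_spaceB p (v w : components A) :
  tangent_space p v -> tangent_space p w -> tangent_space p (v - w).
Proof.
by move=> tv tw; rewrite addrC -scaleN1r; exact: tangent_space_lin.
Qed.

Lemma tangent_space_sum p k (a : 'I_k -> R) (X : 'I_k -> components A) :
  (forall i, tangent_space p (X i)) -> tangent_space p (\sum_i a i *: X i).
Proof.
move=> tX; elim/big_ind : _ => [|v w tv tw|i _]; first exact: tangent_space0.
  by rewrite -[v]scale1r; exact: tangent_space_lin.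
by rewrite -[_ *: _]addr0; apply: tangent_space_lin => //; exact: tangent_space0.
Qed.

End DifferentiableAtlas.

Lemma smooth_atlas_diff (R : realType) (V : normedModType R) (T : Type)
  (A : atlas V T) : smooth_atlas A -> diff_atlas A.
Proof.
move=> [K o s]; split=> // c d z oz.
by apply: (smooth_on_diff _ oz); exact: s.
Qed.

(** * The differential of a tangent map *)

Section DifferentialOfTangentMap.
Context (R : realType).

Lemma is_diff_sum (V W : normedModType R) (I : Type) (r : seq I)
    (f df : I -> V -> W) x : (forall i, is_diff x (f i) (df i)) ->
  is_diff x (fun y => \sum_(i <- r) f i y) (fun v => \sum_(i <- r) df i v).
Proof.
move=> H; elim: r => [|i r IH].
  rewrite [X in is_diff _ X](_ : _ = cst 0); last by apply/funext => y; rewrite big_nil.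
  rewrite [X in is_diff _ _ X](_ : _ = (0 : V -> W)); first exact: is_diff_cst.
  by apply/funext => y; rewrite big_nil.
rewrite [X in is_diff _ X](_ : _ = f i + (fun y => \sum_(i <- r) f i y));
  last by apply/funext => y; rewrite big_cons.
rewrite [X in is_diff _ _ X](_ : _ = df i + (fun y => \sum_(i <- r) df i y));
  last by apply/funext => y; rewrite big_cons.
exact: is_diffD.
Qed.

Lemma is_diff_Zl (V W : normedModType R) (k dk : V -> R) (w : W) x :
  is_diff x k dk -> is_diff x (fun y => k y *: w) (fun v => dk v *: w).
Proof.
move=> [d <-]; apply: DiffDef; first exact: differentiableZl.
exact: diffZl.
Qed.

Lemma is_diff_coord (V : normedModType R) n (f df : V -> 'rV[R]_n) x i :
  is_diff x f df -> is_diff x (fun y => f y 0 i) (fun v => df v 0 i).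
Proof.
move=> [d <-]; apply: DiffDef; first by have [] := diff_coord 0 i d.
by apply/funext => v; have [_ ->] := diff_coord v i d.
Qed.

Lemma is_diff_fst (V W : normedModType R) (x : V * W) : is_diff x fst fst.
Proof.
have c : continuous (fst : {linear (V * W)%type -> V}) by move=> y; exact: cvg_fst.
by apply: DiffDef; [exact: linear_differentiable|rewrite diff_lin].
Qed.

Lemma is_diff_snd (V W : normedModType R) (x : V * W) : is_diff x snd snd.
Proof.
have c : continuous (snd : {linear (V * W)%type -> W}) by move=> y; exact: cvg_snd.
by apply: DiffDef; [exact: linear_differentiable|rewrite diff_lin].
Qed.

Lemma diff_sum_basis (W : normedModType R) n (f : 'rV[R]_n -> W) x (y : 'rV[R]_n) :
  'd f x y = \sum_i y 0 i *: 'd f x (ebasis R i).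
Proof.
by rewrite {1}[y]row_sum_delta linear_sum; apply: eq_bigr => i _; rewrite linearZ.
Qed.

(** In coordinates, [(x, y) |-> 'd f x y] is a sum of products of a coordinate of
    [y] by a derivative of [f] at [x], to which the Leibniz rule applies. *)
Lemma is_diff_tangent_map n m (f : 'rV[R]_n -> 'rV[R]_m)
    (z : 'rV[R]_n * 'rV[R]_n) : let E := ('rV[R]_n * 'rV[R]_n)%type in
  (forall v, differentiable (fun x => 'd f x v) z.1) ->
  is_diff z (fun z' : E => 'd f (z'.1) z'.2)
    (fun w : E => 'd (fun x => 'd f x z.2) (z.1) w.1 + 'd f (z.1) w.2).
Proof.
move=> E d2.
pose a i x := 'd f x (ebasis R i).
have da i : is_diff (z.1) (a i) ('d (a i) (z.1)) by exact/differentiableP/d2.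
have E1 w : 'd (fun x => 'd f x z.2) (z.1) w =
    \sum_j (\sum_i z.2 0 i * ('d (a i) (z.1) w) 0 j) *: ebasis R j.
  have : is_diff (z.1) (fun x => \sum_j (\sum_i z.2 0 i * a i x 0 j) *: ebasis R j)
     (fun w => \sum_j (\sum_i z.2 0 i * ('d (a i) (z.1) w) 0 j) *: ebasis R j).
    apply: is_diff_sum => j; apply: is_diff_Zl; apply: is_diff_sum => i.
    exact: (is_diffZ (z.2 0 i) (is_diff_coord j (da i))).
  move=> [_ /(congr1 (fun F => F w)) dE]; rewrite -[RHS]dE.
  apply: (congr1 (fun F : _ -> _ => 'd F (z.1) w)); apply/funext => x.
  rewrite diff_sum_basis [LHS]row_sum_delta; apply: eq_bigr => j _; congr (_ *: _).
  by rewrite summxE; apply: eq_bigr => i _; rewrite mxE.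
rewrite [X in is_diff _ X](_ : _ =
   fun z' : E => \sum_j (\sum_i z'.2 0 i * a i z'.1 0 j) *: ebasis R j); last first.
  apply/funext => z'.
  rewrite diff_sum_basis [LHS]row_sum_delta; apply: eq_bigr => j _; congr (_ *: _).
  by rewrite summxE; apply: eq_bigr => i _; rewrite mxE.
have D : is_diff z
    (fun z' : E => \sum_j (\sum_i z'.2 0 i * a i z'.1 0 j) *: ebasis R j)
    (fun w : E => \sum_j (\sum_i (z.2 0 i * ('d (a i) (z.1) w.1) 0 j +
                              a i z.1 0 j * w.2 0 i)) *: ebasis R j).
  apply: is_diff_sum => j; apply: is_diff_Zl; apply: is_diff_sum => i.
  have d1 := is_diff_comp (is_diff_fst z) (is_diff_coord j (da i)).
  exact: is_diffM (is_diff_coord i (is_diff_snd z)) d1.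
apply: is_diff_eq D _; apply/funext => w.
apply: (etrans _ (esym (f_equal2 +%R (E1 w.1) (diff_sum_basis f (z.1) w.2)))).
rewrite [X in _ = _ + X]row_sum_delta -big_split; apply: eq_bigr => j _ /=.
rewrite -scalerDl; congr (_ *: _); rewrite big_split summxE; congr (_ + _).
by apply: eq_bigr => i _; rewrite mxE mulrC.
Qed.

End DifferentialOfTangentMap.

(** * The atlas of the tangent bundle *)

Section TangentBundleAtlas.
Context (R : realType) (n : nat) (M : manifold R n).
Notation MA := (mfd_atlas M).
Notation TMA := (tangent_atlas MA).
Notation TM := (M * components MA)%type.
Notation E := ('rV[R]_n * 'rV[R]_n)%type.
Notation index := (chart_index TMA).
Implicit Types (c d : index) (u : TM) (z : E).

Lemma base_diff_atlas : diff_atlas MA.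
Proof. exact/smooth_atlas_diff/mfd_smooth. Qed.
Notation HMA := base_diff_atlas.

Definition base_change c d : 'rV[R]_n -> 'rV[R]_n := transition (A := MA) c d.

Lemma base_change_smooth c d :
  smooth_on (overlap (A := MA) c d) (base_change c d).
Proof. by have [_ _] := mfd_smooth M; apply. Qed.

Lemma tangent_overlapE c d z :
  overlap (A := TMA) c d z <-> overlap (A := MA) c d z.1.
Proof.
split=> [[u [[cu _] [du _]] <-]|[p [cp dp] pE]]; first exact: overlap_chart.
have tp := coord_vector_tangent HMA z.2 cp.
exists (p, coord_vector (A := MA) c p z.2); first by split; split.
by rewrite /= (coord_vector_self HMA) // pE -surjective_pairing.
Qed.

Lemma tangent_overlap_open c d : open (overlap (A := TMA) c d).
Proof.
have -> : overlap (A := TMA) c d = fst @^-1` overlap (A := MA) c d.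
  by apply/seteqP; split=> z /tangent_overlapE.
apply: open_comp => [x _|]; first exact: cvg_fst.
exact: overlap_open HMA _ _.
Qed.

Lemma tangent_transitionE c d z : overlap (A := TMA) c d z ->
  transition (A := TMA) c d z =
  (base_change c d z.1, 'd (base_change c d) (z.1) z.2).
Proof.
move=> /tangent_overlapE /(overlapP HMA)[cp dp zE].
by rewrite /transition /= (coord_vectorE _ cp dp) zE.
Qed.

Lemma base_change_diff2 c d x v : overlap (A := MA) c d x ->
  differentiable (fun y => 'd (base_change c d) y v) x.
Proof.
move=> ox; apply: (smooth_on_diff _ ox).
by apply: smooth_on_deriv; exact: base_change_smooth.
Qed.

Lemma is_diff_tangent_transition c d z : overlap (A := TMA) c d z ->
  is_diff z (fun z' : E => (base_change c d z'.1, 'd (base_change c d) (z'.1) z'.2))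
    (fun w : E => ('d (base_change c d) (z.1) w.1,
      'd (fun x => 'd (base_change c d) x z.2) (z.1) w.1
      + 'd (base_change c d) (z.1) w.2)).
Proof.
move=> oz; have oz1 := (tangent_overlapE c d z).1 oz.
have d1 := differentiableP (diff_transition HMA oz1).
have d2 := is_diff_comp (is_diff_fst z) d1.
have d3 : is_diff z _ _ := @is_diff_tangent_map R n n (base_change c d) z
  (fun v => base_change_diff2 v oz1).
exact: is_diff_pair d2 d3.
Qed.

Lemma tangent_diff_atlas : diff_atlas TMA.
Proof.
split.
- by move=> c [p v] [/= cp tv]; rewrite /= (chartK HMA) // (tangent_coordK cp tv).
- by move=> c d; exact: tangent_overlap_open.
- move=> c d z oz; have [dF _] := is_diff_tangent_transition oz.
  apply: near_eq_differentiable dF.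
  apply: (open_near (@tangent_overlap_open c d) oz) => y oy.
  by rewrite tangent_transitionE.
Qed.

Lemma diff_tangent_transition c d z w : overlap (A := TMA) c d z ->
  'd (transition (A := TMA) c d) z w =
  ('d (base_change c d) (z.1) w.1,
   'd (fun x => 'd (base_change c d) x z.2) (z.1) w.1
   + 'd (base_change c d) (z.1) w.2).
Proof.
move=> oz; have [dF dE] := is_diff_tangent_transition oz.
rewrite -[RHS](congr1 (fun F => F w) dE).
apply: near_eq_diff dF; apply: (open_near (@tangent_overlap_open c d) oz) => y oy.
by rewrite tangent_transitionE.
Qed.

End TangentBundleAtlas.

Lemma diff_jacobian (R : realType) m n (f : 'rV[R]_m -> 'rV[R]_n) x v :
  'd f x v = v *m 'J f x.
Proof. by rewrite /jacobian mul_rV_lin1. Qed.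

(** * Coefficients of nonlinear connections *)

Section NonlinearConnections.
Context (R : realType) (n : nat) (M : manifold R n).
Notation MA := (mfd_atlas M).
Notation TMA := (tangent_atlas MA).
Notation TM := (M * components MA)%type.
Notation E := ('rV[R]_n * 'rV[R]_n)%type.
Notation index := (chart_index TMA).
Notation HMA := (base_diff_atlas M).
Notation HTMA := (tangent_diff_atlas M).
Implicit Types (c d : index) (u : TM) (z : E) (w : components TMA).

(** Vectors are rows: the entry [(k, i)] is [dx'^i/dx^k]. *)
Definition base_jac c d z : 'M[R]_n := 'J (base_change c d) z.1.

(** The entry [(k, i)] is [y^j d^2x'^i/dx^j dx^k]. *)
Definition base_hess c d z : 'M[R]_n :=
  'J (fun x => 'd (base_change c d) x z.2) z.1.

Lemma diff_coord_change c d z (v : E) : overlap (A := TMA) c d z ->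
  'd (transition (A := TMA) c d) z v =
  (v.1 *m base_jac c d z,
   v.1 *m base_hess c d z + v.2 *m base_jac c d z).
Proof.
move=> oz; rewrite (diff_tangent_transition _ oz); congr pair.
  exact: diff_jacobian.
by congr (_ + _); exact: diff_jacobian.
Qed.

Lemma tangent_change c d u w :
  chart_dom (a := TMA) c u -> chart_dom (a := TMA) d u -> tangent_space u w ->
  let z := chart (a := TMA) c u in
  w d = ((w c).1 *m base_jac c d z,
         (w c).1 *m base_hess c d z + (w c).2 *m base_jac c d z).
Proof.
move=> cu du [/(_ c d cu du) -> _] /=.
by rewrite diff_coord_change //; exact: overlap_chart.
Qed.

Lemma base_jacK c d z : overlap (A := TMA) c d z ->
  base_jac c d z *m base_jac d c (coord_change c d z) = 1%:M.
Proof.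
move=> oz; apply/row_matrixP => i; rewrite !rowE mulmx1 mulmxA.
have oz1 := (tangent_overlapE c d z).1 oz.
have [cp dp zE] := overlapP HMA oz1.
set p := chart_inv _ _ in cp dp zE.
have E2 : (coord_change c d z).1 = chart (a := MA) d p.
  by rewrite /coord_change tangent_transitionE.
rewrite -(diff_jacobian (base_change c d)) -(diff_jacobian (base_change d c)) E2 -zE.
rewrite (diff_transition_comp HMA) // (diff_transition_id HMA) //.
exact: chart_img_chart.
Qed.

Lemma base_jacVK c d z : overlap (A := TMA) c d z ->
  base_jac d c (coord_change c d z) *m base_jac c d z = 1%:M.
Proof. by move=> oz; apply: mulmx1C; exact: base_jacK. Qed.

Lemma vertical_chart c u w : chart_dom (a := TMA) c u -> tangent_space u w ->
  vertical u w <-> (w c).1 = 0.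
Proof.
move=> cu tw; split=> [[_ /(congr1 (fun F => F c))]//|w0]; split=> //.
apply/funext => d; rewrite /dproj.
have [du|du] := pselect (chart_dom (a := TMA) d u).
  by rewrite (tangent_change cu du tw) /= w0 mul0mx.
by case: tw => _ /(_ d du) ->.
Qed.

Lemma hproj_spec (N : TM -> set (components TMA)) u w :
  (exists w', N u w' /\ vertical u (w - w')) ->
  N u (hproj N u w) /\ vertical u (w - hproj N u w).
Proof. by move=> ex; have := xgetPex 0 ex. Qed.

Lemma ddx_chart c u j : chart_dom (a := TMA) c u -> ddx c u j c = (ebasis R j, 0).
Proof. by move=> cu; exact: (coord_vector_self HTMA). Qed.

Lemma ddx_tangent c u j : chart_dom (a := TMA) c u -> tangent_space u (ddx c u j).
Proof. by move=> cu; exact: (coord_vector_tangent HTMA). Qed.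

(** Row [j] lists the components of [d/dx^j - h (d/dx^j)] on the [d/dy^i]: this
    is the transpose of the matrix of the [N^i_j], as vectors are rows. *)
Definition conn_mx (N : TM -> set (components TMA)) c z : 'M[R]_n :=
  \matrix_(j, i) conn_coef N c z i j.

(** The law of transformation of the local coefficients,
    [dx'^i/dx^k N^k_j = N'^i_k dx'^k/dx^j + y^k d^2x'^i/dx^k dx^j]. *)
Definition connection_family (b : index -> E -> 'M[R]_n) : Prop :=
  (forall c, smooth_mx (chart_img (A := TMA) c) (b c)) /\
  (forall c d z, overlap (A := TMA) c d z ->
     b c z *m base_jac c d z =
     base_jac c d z *m b d (coord_change c d z) + base_hess c d z).

Definition horizontal_space (b : index -> E -> 'M[R]_n) u : set (components TMA) :=
  [set w | tangent_space u w /\ forall c, chart_dom (a := TMA) c u ->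
     (w c).2 = - (w c).1 *m b c (chart (a := TMA) c u)].

Section FromFamily.
Variable b : index -> E -> 'M[R]_n.
Hypothesis Hb : connection_family b.

(** The law of transformation carries the equation of the horizontal space in one
    chart to its equation in another. *)
Lemma horizontal_spaceP c u w : chart_dom (a := TMA) c u -> tangent_space u w ->
  horizontal_space b u w <-> (w c).2 = - (w c).1 *m b c (chart (a := TMA) c u).
Proof.
move=> cu tw; split=> [[_]|wE]; first exact.
split=> // d du; have oz := overlap_chart cu du.
have [_ /(_ c d _ oz)] := Hb.
rewrite /coord_change (transition_chart HTMA) // => bE.
rewrite (tangent_change cu du tw) /= wE -mulmxA bE mulmxDr !mulNmx.
by rewrite addrCA subrr addr0 mulmxA.
Qed.

End FromFamily.
End NonlinearConnections.

Section ConnectionOfFamily.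
Context (R : realType) (n : nat) (M : manifold R n).
Notation MA := (mfd_atlas M).
Notation TMA := (tangent_atlas MA).
Notation TM := (M * components MA)%type.
Notation E := ('rV[R]_n * 'rV[R]_n)%type.
Notation index := (chart_index TMA).
Notation HTMA := (tangent_diff_atlas M).
Implicit Types (c d : index) (u : TM) (z : E) (w : components TMA).
Variable b : index -> E -> 'M[R]_n.
Hypothesis Hb : connection_family b.

(* The frame [d/dx^i - N^j_i d/dy^j] given by the chart [c]. *)
Let frame c (i : 'I_n) u : components TMA :=
  coord_vector (A := TMA) c u
    (ebasis R i, - row i (b c (chart (a := TMA) c u))).

Let frame_chart c i u : chart_dom (a := TMA) c u ->
  frame c i u c = (ebasis R i, - row i (b c (chart (a := TMA) c u))).
Proof. by move=> cu; exact: (coord_vector_self HTMA). Qed.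

Let frame_sum c u (a : 'I_n -> R) : chart_dom (a := TMA) c u ->
  (\sum_i a i *: frame c i u) c =
  (\row_i a i, - (\row_i a i) *m b c (chart (a := TMA) c u)).
Proof.
move=> cu; rewrite fct_sumE.
under eq_bigr do rewrite fctE frame_chart //.
rewrite sum_pair_scale; congr pair.
  by rewrite [RHS]row_sum_delta; apply: eq_bigr => i _; rewrite mxE.
rewrite mulNmx mulmx_sum_row -sumrN; apply: eq_bigr => i _.
by rewrite mxE scalerN.
Qed.

Let frame_smooth c i :
  smooth_on (chart_img (A := TMA) c) (fun z => frame c i (chart_inv (a := TMA) c z) c).
Proof.
have oI := @chart_img_open _ _ _ _ HTMA c.
have sb j : smooth_on (chart_img (A := TMA) c)
    (fun z => - b c z i j *: ((0, ebasis R j) : E)).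
  move=> k; apply: Ck_onZl => //.
  have C := Ck_onM oI (Ck_on_cst oI k (-1 : R)) (Hb.1 c i j k).
  by apply: Ck_on_congr C => // z _; rewrite mulN1r.
have ss := smooth_on_sum oI (index_enum 'I_n) (P := xpredT) (fun j _ => sb j).
move=> k; have C := Ck_onD oI (Ck_on_cst oI k ((ebasis R i, 0) : E)) (ss k).
apply: Ck_on_congr C => // z Iz.
have [cu zE] := chart_imgP HTMA Iz.
rewrite frame_chart // zE sum_pair_scale.
rewrite -[LHS]/(ebasis R i + _, 0 + _) add0r big1 ?addr0; last first.
  by move=> j _; exact: scaler0.
congr pair; rewrite [RHS]row_sum_delta; apply: eq_bigr => j _.
by rewrite !mxE.
Qed.

Let N := horizontal_space b.

Let N_distribution : distribution n N.
Proof.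
move=> c u cu.
exists (chart_img (A := TMA) c), (frame c); split.
- exact: chart_img_open HTMA _.
- exact: chart_img_chart.
- by [].
- exact: frame_smooth.
move=> z Iz q; have [cq zE] := chart_imgP HTMA Iz.
have tf i : tangent_space q (frame c i q) by exact: (coord_vector_tangent HTMA).
split=> //.
  move=> a /(congr1 (fun F => F c)); rewrite frame_sum // => -[a0 _] i.
  by move/rowP : a0 => /(_ i); rewrite !mxE.
apply/seteqP; split=> [w Nw|w [a ->]].
  have [tw _] := Nw; exists (fun i => (w c).1 0 i).
  apply: (tangent_eq cq tw); first exact: tangent_space_sum.
  rewrite frame_sum //; have /(horizontal_spaceP Hb cq tw) := Nw.
  have -> : \row_i (w c).1 0 i = (w c).1 by apply/rowP => i; rewrite mxE.
  by move=> <-; exact: surjective_pairing.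
have ts : tangent_space q (\sum_i a i *: frame c i q) by exact: tangent_space_sum.
by apply/(horizontal_spaceP Hb cq ts); rewrite frame_sum.
Qed.

Let hor c u (w : components TMA) : components TMA := coord_vector (A := TMA) c u
  ((w c).1, - (w c).1 *m b c (chart (a := TMA) c u)).

Let N_hor c u w : chart_dom (a := TMA) c u -> tangent_space u w ->
  [/\ tangent_space u (hor c u w), N u (hor c u w) & vertical u (w - hor c u w)].
Proof.
move=> cu tw.
have hc : hor c u w c = ((w c).1, - (w c).1 *m b c (chart (a := TMA) c u)).
  exact: (coord_vector_self HTMA).
have th : tangent_space u (hor c u w) by exact: (coord_vector_tangent HTMA).
split=> //; first by apply/(horizontal_spaceP Hb cu th); rewrite hc.
have tB := tangent_spaceB tw th.
apply/(vertical_chart cu tB).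
by rewrite /= -[LHS]/((w c).1 - (hor c u w c).1) hc subrr.
Qed.

Lemma family_nonlinear_connection : nonlinear_connection N.
Proof.
split=> [|c u cu]; first exact: N_distribution.
split; apply/seteqP; split=> w.
- move=> [Nw vw]; have tw := Nw.1.
  have /(horizontal_spaceP Hb cu tw) w2 := Nw.
  have /(vertical_chart cu tw) w1 := vw.
  apply: (tangent_eq cu tw (tangent_space0 _ u)).
  by rewrite [LHS]surjective_pairing w2 w1 oppr0 mul0mx.
- move=> ->; have t0 := tangent_space0 TMA u; split.
    by apply/(horizontal_spaceP Hb cu t0); rewrite /= oppr0 mul0mx.
  by apply/(vertical_chart cu t0).
- move=> tw; have [_ Nh vh] := N_hor cu tw.
  by exists (hor c u w), (w - hor c u w); split=> //; rewrite addrC subrK.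
- move=> [w1 [w2 [[t1 _] [t2 _] ->]]].
  by rewrite -[w1]scale1r; exact: tangent_space_lin.
Qed.

Lemma family_conn_mx c z : chart_img (A := TMA) c z -> conn_mx N c z = b c z.
Proof.
move=> Iz; have [cu zE] := chart_imgP HTMA Iz; set u := chart_inv c z in cu zE.
apply/matrixP => j i; rewrite mxE /conn_coef -/u.
have td := ddx_tangent j cu; have [_ Nh vh] := N_hor cu td.
have [Np vp] := hproj_spec (ex_intro _ _ (conj Nh vh)).
have /(horizontal_spaceP Hb cu Np.1) -> := Np.
have /(vertical_chart cu (tangent_spaceB td Np.1)) := vp.
rewrite -[LHS]/((ddx c u j c).1 - (hproj N u (ddx c u j) c).1) ddx_chart // => /eqP.
rewrite subr_eq0 => /eqP <-; rewrite zE mulNmx /ebasis -rowE mxE opprK.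
by rewrite mxE.
Qed.

End ConnectionOfFamily.

Section FamilyOfConnection.
Context (R : realType) (n : nat) (M : manifold R n).
Notation MA := (mfd_atlas M).
Notation TMA := (tangent_atlas MA).
Notation TM := (M * components MA)%type.
Notation E := ('rV[R]_n * 'rV[R]_n)%type.
Notation index := (chart_index TMA).
Notation HTMA := (tangent_diff_atlas M).
Implicit Types (c d : index) (u : TM) (z : E) (w : components TMA).
Variable N : TM -> set (components TMA).
Hypothesis HN : nonlinear_connection N.

Let N_lin c u (a : R) w1 w2 : chart_dom (a := TMA) c u ->
  N u w1 -> N u w2 -> N u (a *: w1 + w2).
Proof.
move=> cu; have [/(_ c u cu)[W [X [_ Wu _ _ /(_ _ Wu) XP]]] _] := HN.
move: XP; cbv zeta; rewrite (chartK HTMA cu) => -[_ _ ->] [a1 ->] [a2 ->].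
exists (fun i => a * a1 i + a2 i).
rewrite scaler_sumr -big_split; apply: eq_bigr => i _ /=.
by rewrite scalerDl scalerA.
Qed.

Let N_sub c u w : chart_dom (a := TMA) c u -> N u w -> tangent_space u w.
Proof.
move=> cu Nw; have [_ /(_ c u cu)[_ ->]] := HN.
exists w, 0; split=> //; last by rewrite addr0.
by apply/(vertical_chart cu (tangent_space0 _ u)).
Qed.

Let N_sum c u k (a : 'I_k -> R) (X : 'I_k -> components TMA) :
  chart_dom (a := TMA) c u -> (forall i, N u (X i)) -> N u (\sum_i a i *: X i).
Proof.
move=> cu NX; have N0 : N u 0.
  have [_ /(_ c u cu)[NV _]] := HN.
  by have : [set (0 : components TMA)] 0 by []; rewrite -NV => -[].
elim/big_ind : _ => // [v w Nv Nw|i _].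
  by rewrite -[v]scale1r; exact: N_lin cu _ _.
by rewrite -[_ *: _]addr0; exact: N_lin cu _ _.
Qed.

Let N_vertical c u w : chart_dom (a := TMA) c u -> N u w -> (w c).1 = 0 -> w = 0.
Proof.
move=> cu Nw w0; have [_ /(_ c u cu)[NV _]] := HN.
suff : [set (0 : components TMA)] w by [].
by rewrite -NV; split=> //; apply/(vertical_chart cu (N_sub cu Nw)).
Qed.

Let hproj_ddx c u j : chart_dom (a := TMA) c u ->
  N u (hproj N u (ddx c u j)) /\
  hproj N u (ddx c u j) c =
    (ebasis R j, - row j (conn_mx N c (chart (a := TMA) c u))).
Proof.
move=> cu; have td := ddx_tangent j cu.
have [Np vp] : N u (hproj N u (ddx c u j)) /\
    vertical u (ddx c u j - hproj N u (ddx c u j)).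
  apply: hproj_spec; move: td; have [_ /(_ c u cu)[_ ->]] := HN.
  by move=> [w1 [w2 [Nw1 vw2 ->]]]; exists w1; rewrite addrC addKr.
split=> //; set p := hproj _ _ _ in Np vp *.
rewrite [LHS]surjective_pairing; congr pair.
  have /(vertical_chart cu (tangent_spaceB td (N_sub cu Np))) := vp.
  rewrite -[LHS]/((ddx c u j c).1 - (p c).1) ddx_chart // => /eqP.
  by rewrite subr_eq0 => /eqP <-.
by apply/rowP => i; rewrite !mxE /conn_coef (chartK HTMA cu) opprK.
Qed.

(** A complement of the vertical space is the graph of a linear map, whose matrix
    is read on the projections of the [d/dx^j]. *)
Lemma nonlinear_connectionP c u w : chart_dom (a := TMA) c u -> tangent_space u w ->
  N u w <-> (w c).2 = - (w c).1 *m conn_mx N c (chart (a := TMA) c u).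
Proof.
move=> cu tw; pose h := \sum_j (w c).1 0 j *: hproj N u (ddx c u j).
have Nh : N u h by apply: (N_sum _ cu) => j; have [] := hproj_ddx j cu.
have hc : h c = ((w c).1, - (w c).1 *m conn_mx N c (chart (a := TMA) c u)).
  rewrite /h fct_sumE; under eq_bigr => j _.
    rewrite fctE; have [_ ->] := hproj_ddx j cu; over.
  rewrite sum_pair_scale; congr pair; first by rewrite [RHS]row_sum_delta.
  by rewrite mulNmx mulmx_sum_row -sumrN; apply: eq_bigr => j _; rewrite scalerN.
split=> [Nw|wE]; last first.
  suff -> : w = h by [].
  by apply: (tangent_eq cu tw (N_sub cu Nh)); rewrite hc -wE -surjective_pairing.
suff -> : w = h by rewrite hc.
apply/eqP; rewrite -subr_eq0; apply/eqP; apply: (N_vertical cu).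
  by rewrite addrC -scaleN1r; exact: N_lin cu _ _.
by rewrite -[LHS]/((w c).1 - (h c).1) hc subrr.
Qed.

(* If the vectors of a smooth frame of [N] have components [F i] and [Q i], then
   [Q = - F *m conn_mx N], and [F] is invertible because a combination of the
   frame with zero first components would be vertical. *)
Let conn_mx_smooth c : smooth_mx (chart_img (A := TMA) c) (conn_mx N c).
Proof.
move=> i j k; apply: Ck_on_local => z Iz.
have [cu zE] := chart_imgP HTMA Iz; set u := chart_inv c z in cu zE.
have [/(_ c u cu)[W [X [oW Wu WI sX XP]]] _] := HN.
exists W; first by rewrite -zE.
pose F z' : 'M[R]_n := \matrix_(i, j) (X i (chart_inv (a := TMA) c z') c).1 0 j.
pose Q z' : 'M[R]_n := \matrix_(i, j) (X i (chart_inv (a := TMA) c z') c).2 0 j.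
have sF : smooth_mx W F.
  move=> a e l; have := smooth_on_rV oW (smooth_on_fst oW (sX a)) 0 e l.
  by apply: Ck_on_congr => // z' _; rewrite mxE.
have sQ : smooth_mx W Q.
  move=> a e l; have := smooth_on_rV oW (smooth_on_snd oW (sX a)) 0 e l.
  by apply: Ck_on_congr => // z' _; rewrite mxE.
have NX z' a : W z' -> N (chart_inv c z') (X a (chart_inv c z')).
  move=> Wz; have [_ _ ->] := XP z' Wz.
  exists (fun e => (e == a)%:R); rewrite (bigD1 a) //= eqxx scale1r big1 ?addr0 //.
  by move=> e /negbTE ->; rewrite scale0r.
have uF z' : W z' -> F z' \in unitmx.
  move=> Wz; have [cu' _] := chart_imgP HTMA (WI _ Wz).
  rewrite unitmxE unitfE; apply/det0P => -[a a0 aF].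
  have [_ Xfree _] := XP z' Wz.
  have S0 : \sum_e a 0 e *: X e (chart_inv c z') = 0.
    apply: (N_vertical cu'); first by apply: (N_sum _ cu') => e; exact: NX.
    rewrite fct_sumE (raddf_sum (fst : {additive E -> 'rV[R]_n})).
    rewrite -[RHS]aF mulmx_sum_row.
    apply: eq_bigr => e _; rewrite fctE /=; congr (_ *: _).
    by apply/rowP => l; rewrite !mxE.
  by move/eqP : a0; apply; apply/rowP => e; rewrite (Xfree (fun e => a 0 e) S0) mxE.
have sV := smooth_mxN oW (smooth_mxM oW (smooth_invmx oW uF sF) sQ).
move: i j k; apply: (smooth_mx_congr oW _ sV) => z' Wz.
have [cu' zE'] := chart_imgP HTMA (WI _ Wz).
have -> : Q z' = - F z' *m conn_mx N c z'.
  apply/row_matrixP => a; rewrite row_mul linearN /=.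
  have Na := NX z' a Wz.
  have /(nonlinear_connectionP cu' (N_sub cu' Na)) := Na; rewrite zE' => E2.
  have -> : row a (F z') = (X a (chart_inv c z') c).1 by apply/rowP => l; rewrite !mxE.
  by rewrite -E2; apply/rowP => l; rewrite !mxE.
by rewrite mulNmx mulmxN opprK mulKmx // uF.
Qed.

Lemma nonlinear_connection_family : connection_family (conn_mx N).
Proof.
split=> [|c d z oz]; first exact: conn_mx_smooth.
have [cu du zE] := overlapP HTMA oz; set u := chart_inv c z in cu du zE.
apply/row_matrixP => j.
have [Np pc] := hproj_ddx j cu; set p := hproj _ _ _ in Np pc.
have tp := N_sub cu Np.
have /(nonlinear_connectionP du tp) E1 := Np.
have tc := tangent_change cu du tp; cbv zeta in tc; rewrite zE in pc tc.
have cdE : chart (a := TMA) d u = coord_change c d z.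
  by rewrite -(transition_chart HTMA d cu) zE.
have aux (P h C B : 'M[R]_n) :
    ebasis R j *m h + - row j C *m P = - (ebasis R j *m P) *m B ->
    row j (C *m P) = row j (P *m B + h).
  rewrite !mulNmx -mulmxA -!rowE -row_mul => /eqP; rewrite subr_eq => /eqP E2.
  by rewrite linearD /= E2 addNKr.
by apply: aux; move: E1; rewrite tc pc cdE.
Qed.

End FamilyOfConnection.

(** * Local coefficients of semisprays *)

Section SprayCoefficients.
Context (R : realType) (n : nat) (M : manifold R n).
Notation MA := (mfd_atlas M).
Notation TMA := (tangent_atlas MA).
Notation TM := (M * components MA)%type.
Notation E := ('rV[R]_n * 'rV[R]_n)%type.
Notation index := (chart_index TMA).
Notation HMA := (base_diff_atlas M).
Notation HTMA := (tangent_diff_atlas M).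
Implicit Types (c d : index) (u : TM) (z : E).
Variable S : TM -> components TMA.
Hypothesis HS : semispray S.

Lemma semispray_fst c z : chart_img (A := TMA) c z ->
  (S (chart_inv (a := TMA) c z) c).1 = z.2.
Proof.
move=> Iz; have [cu zE] := chart_imgP HTMA Iz; set u := chart_inv c z in cu zE *.
have [_ /(_ c u cu) /(congr1 (fun F => F c))] := HS.
by rewrite /almost_tangent /liouville -zE => -[].
Qed.

Lemma semispray_tangent c z : chart_img (A := TMA) c z ->
  tangent_space (chart_inv (a := TMA) c z) (S (chart_inv (a := TMA) c z)).
Proof. by move=> /(chart_imgP HTMA)[cu _]; have [[+ _] _] := HS; apply; exact: cu. Qed.

Lemma overlap_img c d z : overlap (A := TMA) c d z -> chart_img (A := TMA) c z.
Proof. by move=> [u [cu _] <-]; exact: chart_img_chart. Qed.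

Lemma overlap_img_transition c d z : overlap (A := TMA) c d z ->
  chart_img (A := TMA) d (coord_change c d z).
Proof. by move=> /(overlap_transition HTMA)/overlap_img. Qed.

Lemma semispray_change c d z : overlap (A := TMA) c d z ->
  S (chart_inv (a := TMA) d (coord_change c d z)) d =
  'd (transition (A := TMA) c d) z (S (chart_inv (a := TMA) c z) c).
Proof.
move=> oz; rewrite /coord_change (transition_inv HTMA) //.
have [cu du zE] := overlapP HTMA oz.
have [/(_ c d cu du) -> _] := semispray_tangent (overlap_img oz).
by rewrite zE.
Qed.

Lemma spray_coef_smooth c i :
  smooth_on (chart_img (A := TMA) c) (fun z => spray_coef S c z i).
Proof.
have oI := @chart_img_open _ _ _ _ HTMA c.
have [[_ /(_ c) sS] _] := HS.
have s2 := smooth_on_rV oI (smooth_on_snd oI sS) 0 i.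
by move=> k; apply: Ck_on_congr (Ck_onM oI (Ck_on_cst oI k (- 2^-1 : R)) (s2 k)).
Qed.

(** The second differential of a coordinate change at [x]; [base_hess] is its
    contraction with [y]. *)
Definition change_hess c d x (v w : 'rV[R]_n) : 'rV[R]_n :=
  'd (fun x' => 'd (base_change c d) x' v) x w.

Lemma change_hessC c d x v w : overlap (A := MA) c d x ->
  change_hess c d x v w = change_hess c d x w v.
Proof.
move=> ox; apply: (Schwarz_rV v w _ ox); last exact: base_change_smooth.
exact: overlap_open HMA _ _.
Qed.

Lemma change_hessE c d z w : change_hess c d z.1 z.2 w = w *m base_hess c d z.
Proof. exact: diff_jacobian. Qed.

Lemma change_hess_sum c d x v w : overlap (A := MA) c d x ->
  change_hess c d x v w = \sum_i v 0 i *: change_hess c d x (ebasis R i) w.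
Proof.
move=> ox; rewrite change_hessC // [LHS]diff_sum_basis.
by apply: eq_bigr => i _; rewrite [in RHS]change_hessC.
Qed.

(** As the first component of [S] is [y], the differential of a change of
    coordinates adds to the second one a term quadratic in [y]. *)
Lemma spray_coef_change c d z i : overlap (A := TMA) c d z ->
  spray_coef S d (coord_change c d z) i =
  \sum_k spray_coef S c z k * base_jac c d z k i
  - 2^-1 * (change_hess c d z.1 z.2 z.2) 0 i.
Proof.
move=> oz; rewrite /spray_coef semispray_change // diff_coord_change // /=.
rewrite (semispray_fst (overlap_img oz)) -(change_hessE c d z) mxE mulrDr addrC !mulNr.
congr (_ - _); rewrite mxE mulr_sumr -sumrN; apply: eq_bigr => k _.
by rewrite !mulNr mulrA.
Qed.

Definition spray_jac c z : 'M[R]_n :=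
  \matrix_(k, s) 'd (fun z' => spray_coef S c z' s) z (0, ebasis R k).

Lemma is_diff_fibre (f : E -> R) z : differentiable f z ->
  is_diff (z.2) (fun y => f (z.1, y)) (fun v => 'd f z (0, v)).
Proof.
move=> df.
have dp : is_diff (z.2) (fun y => (z.1, y) : E) (fun v => (0, v)).
  exact: is_diff_pair (is_diff_cst _ _) (is_diff_id _).
rewrite [X in 'd _ X]surjective_pairing.
apply: (is_diff_comp dp); apply: differentiableP.
by rewrite -surjective_pairing.
Qed.

End SprayCoefficients.

Section SprayJacobian.
Context (R : realType) (n : nat) (M : manifold R n).
Notation MA := (mfd_atlas M).
Notation TMA := (tangent_atlas MA).
Notation TM := (M * components MA)%type.
Notation E := ('rV[R]_n * 'rV[R]_n)%type.
Notation index := (chart_index TMA).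
Notation HTMA := (tangent_diff_atlas M).
Implicit Types (c d : index) (z : E).
Variable S : TM -> components TMA.
Hypothesis HS : semispray S.

Lemma diff_fibre_sum (f : E -> R) z w :
  'd f z (0, w) = \sum_l w 0 l * 'd f z (0, ebasis R l).
Proof.
have -> : (0, w) = \sum_l w 0 l *: ((0, ebasis R l) : E).
  rewrite sum_pair_scale big1 => [|l _]; last exact: scaler0.
  by congr pair; exact: row_sum_delta.
by rewrite linear_sum; apply: eq_bigr => l _; exact: linearZ.
Qed.

Lemma is_diff_change_hess_quadratic c d x (y : 'rV[R]_n) i :
  overlap (A := MA) c d x ->
  is_diff y (fun y' => (change_hess (M := M) c d x y' y') 0 i)
    (fun v => 2 * (change_hess (M := M) c d x y v) 0 i).
Proof.
move=> ox.
have lin j : is_diff y (change_hess (M := M) c d x (ebasis R j))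
    (change_hess (M := M) c d x (ebasis R j)).
  have cj := diff_continuous (base_change_diff2 (ebasis R j) ox).
  by apply: DiffDef; [exact: linear_differentiable|exact: diff_lin].
have sE v w : (change_hess (M := M) c d x v w) 0 i =
    \sum_j v 0 j * (change_hess (M := M) c d x (ebasis R j) w) 0 i.
  by rewrite change_hess_sum // summxE; apply: eq_bigr => j _; rewrite mxE.
rewrite [X in is_diff _ X](_ : _ = fun y' : 'rV[R]_n =>
    \sum_j y' 0 j * (change_hess (M := M) c d x (ebasis R j) y') 0 i); last first.
  by apply/funext => y'.
have D : is_diff y (fun y' : 'rV[R]_n =>
    \sum_j y' 0 j * (change_hess (M := M) c d x (ebasis R j) y') 0 i)
    (fun v : 'rV[R]_n =>
     \sum_j (y 0 j * (change_hess (M := M) c d x (ebasis R j) v) 0 i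
           + (change_hess (M := M) c d x (ebasis R j) y) 0 i * v 0 j)).
  apply: is_diff_sum => j.
  exact: is_diffM (is_diff_coord j (is_diff_id y)) (is_diff_coord i (lin j)).
apply: is_diff_eq D _; apply/funext => v.
rewrite big_split /= -sE mulr2n mulrDl mul1r; congr (_ + _).
transitivity ((change_hess (M := M) c d x v y) 0 i); last first.
  by congr (fun_of_matrix _ 0 i); exact: change_hessC.
by apply: etrans (esym (sE v y)); apply: eq_bigr => j _; exact: mulrC.
Qed.

(** [spray_coef_change] differentiated along the fibre, on which the Jacobian
    matrix is constant. By symmetry of the second differential, half of the
    quadratic term contributes exactly [base_hess]. *)
Lemma spray_jac_change c d z : overlap (A := TMA) c d z ->
  base_jac c d z *m spray_jac S d (coord_change c d z) =
  spray_jac S c z *m base_jac c d z - base_hess c d z.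
Proof.
move=> oz; have oz1 := (tangent_overlapE c d z).1 oz.
have Iz := overlap_img oz; have Iz' := overlap_img_transition oz.
have ds c' i z' : chart_img (A := TMA) c' z' ->
    differentiable (fun y => spray_coef S c' y i) z'.
  exact: (smooth_on_diff (spray_coef_smooth HS c' i)).
apply/matrixP => k i.
pose v := ebasis R k; pose P := base_jac c d z.
pose Y w : E := (z.1, w).
have oY w : overlap (A := TMA) c d (Y w) by apply/tangent_overlapE.
have dcc := diff_transition HTMA oz.
have dd : differentiable (fun z' => spray_coef S d (coord_change c d z') i) z.
  exact: differentiable_comp dcc (ds d i _ Iz').
have D1 := is_diff_fibre dd.
have D2 : is_diff (z.2) (fun w => spray_coef S d (coord_change c d (Y w)) i)
    (fun w => \sum_l P l i * 'd (fun z' => spray_coef S c z' l) z (0, w)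
       - 2^-1 * (2 * (change_hess (M := M) c d z.1 z.2 w) 0 i)).
  rewrite [X in is_diff _ X](_ : _ = fun w =>
     \sum_l P l i * spray_coef S c (Y w) l
     - 2^-1 * (change_hess (M := M) c d z.1 w w) 0 i); last first.
    apply/funext => w; rewrite spray_coef_change //; congr (_ - _).
    by apply: eq_bigr => l _; rewrite mulrC.
  have DB := is_diffZ (2^-1) (is_diff_change_hess_quadratic z.2 i oz1).
  have DA l := is_diffZ (P l i) (is_diff_fibre (ds _ l _ Iz)).
  exact: is_diffB (is_diff_sum _ DA) DB.
have [_ E1] := D1; have [_ E2] := D2.
have E3 := congr1 (fun F => F v) (etrans (esym E1) E2).
have ccv : 'd (transition (A := TMA) c d) z (0, v) = (0, row k P).
  apply: (etrans (diff_tangent_transition (0, v) oz)).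
  congr pair; first exact: linear0.
  apply: (etrans (f_equal2 +%R (linear0 _) (diff_jacobian (base_change c d) (z.1) v))).
  by rewrite add0r rowE.
have E4 := diff_compE (0, v) dcc (ds d i _ Iz').
have E5 := diff_fibre_sum (fun y => spray_coef S d y i) (coord_change c d z) (row k P).
have {}E4 := etrans E4 (etrans (congr1 _ ccv) E5).
have hk : (change_hess (M := M) c d z.1 z.2 v) 0 i = base_hess c d z k i.
  by rewrite change_hessE -rowE mxE.
transitivity (\sum_l row k P 0 l * 'd (fun y => spray_coef S d y i)
    (coord_change c d z) (0, ebasis R l)).
  rewrite mxE; apply: eq_bigr => l _.
  by congr (_ * _); [rewrite [RHS]mxE|rewrite mxE].
apply: (etrans (esym E4)); apply: (etrans E3).
have aux (A B C : 'M[R]_n) : (A *m B - C) k i = \sum_l A k l * B l i - C k i.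
  by rewrite !mxE.
apply: (etrans _ (esym (aux _ _ _))); congr (_ - _); last first.
  by apply: etrans hk; rewrite mulKf ?pnatr_eq0.
by apply: eq_bigr => l _; rewrite mulrC; congr (_ * _); rewrite mxE.
Qed.

End SprayJacobian.

(** * Matrix algebra at a point *)

Section PointwiseAlgebra.
Context (R : realType) (n : nat).
Implicit Types (P Q G L C X h : 'M[R]_n).

(** The matrix of the [N^{ci}_j], for [G] the matrix of the [g_ij], [L] that of
    the [S(g_ij)] and [C] that of the [dG^s/dy^k], with [k] as row index. *)
Definition canonical_of G L C : 'M[R]_n :=
  2^-1 *: (invmx G *m L + C^T - invmx G *m C *m G).

(** The matrix of the [O^{ki}_{jm} X^m_k]. *)
Definition obata_of G X : 'M[R]_n :=
  2^-1 *: (X - (invmx G)^T *m X^T *m G^T).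

Lemma half_double X : 2^-1 *: (X + X) = X.
Proof. by apply/matrixP => i j; rewrite !mxE; field. Qed.

Lemma congruence_inv P Q G G' : G \in unitmx -> G' \in unitmx ->
  Q *m P = 1%:M -> G = P *m G' *m P^T -> P^T *m invmx G = invmx G' *m Q.
Proof.
move=> uG uG' QP GE; rewrite -[RHS](mulmxK uG); congr (_ *m _).
by rewrite GE -!mulmxA (mulmxA Q) QP mul1mx mulKmx.
Qed.

(** Both [L] and [C^T] bring in [h]. From [L] come [h^T] and a term conjugate to
    [h] by the metric; from [C^T] comes [h^T]; and the last term of the formula
    cancels the conjugate of [h]. The half sum leaves [h^T] once. *)
Lemma canonical_of_change P Q G G' L L' C C' h :
  G \in unitmx -> G' \in unitmx -> Q *m P = 1%:M ->
  G = P *m G' *m P^T ->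
  L = h *m G' *m P^T + P *m L' *m P^T + P *m G' *m h^T ->
  P *m C' = C *m P - h ->
  (canonical_of G L C)^T *m P = P *m (canonical_of G' L' C')^T + h.
Proof.
move=> uG uG' QP GE LE CE; apply: trmx_inj.
rewrite linearD /= !trmx_mul !trmxK /canonical_of -scalemxAr -scalemxAl.
have CP : C *m P = P *m C' + h by rewrite CE subrK.
rewrite -[h^T in RHS]half_double -scalerDr; congr (_ *: _).
rewrite mulmxBr mulmxDr !mulmxA (congruence_inv uG uG' QP GE).
rewrite -[P^T *m C^T]trmx_mul CP linearD /= trmx_mul.
have -> : invmx G' *m Q *m L =
    invmx G' *m Q *m h *m G' *m P^T + invmx G' *m L' *m P^T + h^T.
  rewrite LE !mulmxDr; congr (_ + _ + _); first by rewrite !mulmxA.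
    by rewrite -!mulmxA (mulmxA Q) QP mul1mx.
  by rewrite -!mulmxA (mulmxA Q) QP mul1mx mulKmx.
have -> : invmx G' *m Q *m C *m G =
    invmx G' *m C' *m G' *m P^T + invmx G' *m Q *m h *m G' *m P^T.
  rewrite GE !mulmxA -(mulmxA _ C P) CP mulmxDr !mulmxDl; congr (_ + _).
  by rewrite -!mulmxA (mulmxA Q) QP mul1mx.
rewrite mulmxBl mulmxDl.
move: (invmx G' *m Q *m h *m G' *m P^T) (invmx G' *m L' *m P^T)
  (C'^T *m P^T) (invmx G' *m C' *m G' *m P^T) (h^T) => a1 a2 a3 a4 a5.
by apply/matrixP => i j; rewrite !mxE; ring.
Qed.

Lemma obata_of_change P Q G G' X X' : G^T = G -> G'^T = G' ->
  G \in unitmx -> G' \in unitmx -> Q *m P = 1%:M -> G = P *m G' *m P^T ->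
  X' = P^T *m X *m Q^T ->
  (obata_of G X)^T *m P = P *m (obata_of G' X')^T.
Proof.
move=> sG sG' uG uG' QP GE XE; apply: trmx_inj.
have PQ : Q^T *m P^T = 1%:M by rewrite -trmx_mul (mulmx1C QP) trmx1.
rewrite !trmx_mul !trmxK /obata_of -scalemxAr -scalemxAl; congr (_ *: _).
rewrite !trmx_inv sG sG' mulmxBr mulmxBl; congr (_ - _).
  by rewrite XE -!mulmxA PQ mulmx1.
rewrite !mulmxA (congruence_inv uG uG' QP GE) XE !trmx_mul !trmxK.
by rewrite GE !mulmxA.
Qed.

(** [G *m canonical_of G L C] is the sum of half of [L] and of a skew matrix. *)
Lemma canonical_of_metric G L C : G \in unitmx -> G^T = G -> L^T = L ->
  (canonical_of G L C)^T *m G + G *m canonical_of G L C = L.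
Proof.
move=> uG sG sL.
have E : G *m canonical_of G L C = 2^-1 *: (L + G *m C^T - C *m G).
  rewrite /canonical_of -scalemxAr; congr (_ *: _).
  by rewrite mulmxBr mulmxDr -!mulmxA !mulKVmx.
rewrite -[X in _ *m X + _]sG -trmx_mul E -[RHS]half_double linearZ -scalerDr.
congr (_ *: _); rewrite /= linearB linearD /= !trmx_mul trmxK sG sL.
by apply/matrixP => i j; rewrite !mxE; ring.
Qed.

(** [G *m obata_of G X] is skew. *)
Lemma obata_of_metric G X : G \in unitmx -> G^T = G ->
  (obata_of G X)^T *m G + G *m obata_of G X = 0.
Proof.
move=> uG sG.
have E : G *m obata_of G X = 2^-1 *: (G *m X - X^T *m G).
  rewrite /obata_of -scalemxAr; congr (_ *: _).
  by rewrite mulmxBr trmx_inv sG -!mulmxA mulKVmx.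
rewrite -[X in _ *m X + _]sG -trmx_mul E linearZ -scalerDr.
rewrite /= linearB /= !trmx_mul trmxK sG.
by rewrite addrC subrKA subrr scaler0.
Qed.

(** With [obata_of_metric]: the Obata operator is a projector, onto the matrices
    [X] such that [G *m X] is skew. *)
Lemma obata_of_fixed G X : G \in unitmx -> G^T = G ->
  X^T *m G + G *m X = 0 -> obata_of G X = X.
Proof.
move=> uG sG /eqP; rewrite addr_eq0 => /eqP E.
by rewrite /obata_of trmx_inv sG -mulmxA E mulmxN mulKmx // opprK half_double.
Qed.

(** With [change_submx]: the solutions of the law of transformation of connections
    form an affine space over those of the law of the (1,1) tensors. *)
Lemma change_addmx P Q h C C' X X' : P *m Q = 1%:M ->
  C *m P = P *m C' + h -> X' = P^T *m X *m Q^T ->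
  (C + X^T) *m P = P *m (C' + X'^T) + h.
Proof.
move=> PQ CE ->; rewrite mulmxDl mulmxDr CE !trmx_mul !trmxK !mulmxA PQ mul1mx.
by rewrite addrAC.
Qed.

Lemma change_submx P Q h C C' L L' : Q *m P = 1%:M ->
  C *m P = P *m C' + h -> L *m P = P *m L' + h ->
  (C' - L')^T = P^T *m (C - L)^T *m Q^T.
Proof.
move=> QP CE LE; rewrite -!trmx_mul mulmxBl CE LE opprD addrACA subrr addr0.
by rewrite -mulmxBr mulmxA QP mul1mx.
Qed.

Lemma change_trmx P Q X X' : Q *m P = 1%:M ->
  X^T *m P = P *m X'^T -> X' = P^T *m X *m Q^T.
Proof.
move=> QP XE; apply: trmx_inj.
by rewrite !trmx_mul !trmxK XE mulmxA QP mul1mx.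
Qed.

(** With [x] and [y] the components of two vertical fields, and [xi] and [eta]
    the derivatives of these components along the semispray, the left-hand side
    is [(nabla g)(x, y)] as defined, and the derivatives [xi], [eta] drop out. *)
Lemma connection_defect G C L (x y xi eta : 'rV[R]_n) :
  (x *m G *m eta^T + xi *m G *m y^T + x *m L *m y^T) 0 0
  - ((xi + x *m C) *m G *m y^T) 0 0 - (x *m G *m (eta + y *m C)^T) 0 0 =
  (x *m (L - C *m G - G *m C^T) *m y^T) 0 0.
Proof.
have aux (A1 A2 A3 : 'M[R]_1) : A1 0 0 - A2 0 0 - A3 0 0 = (A1 - A2 - A3) 0 0.
  by rewrite !mxE.
rewrite aux; congr (fun_of_matrix _ 0 0).
rewrite linearD /= trmx_mul !mulmxBr !mulmxBl !mulmxDl !mulmxDr !mulmxA.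
move: (x *m G *m eta^T) (xi *m G *m y^T) (x *m L *m y^T) (x *m C *m G *m y^T)
  (x *m G *m C^T *m y^T) => a1 a2 a3 a4 a5.
by apply/matrixP => i j; rewrite !mxE; ring.
Qed.

End PointwiseAlgebra.

Lemma mulmx_trE (R : realType) m n p q (A : 'M[R]_(m, n)) (B : 'M[R]_(n, p))
    (C : 'M[R]_(q, p)) i j :
  (A *m B *m C^T) i j = \sum_k \sum_l A i k * B k l * C j l.
Proof.
rewrite mxE exchange_big; apply: eq_bigr => l _ /=.
by rewrite !mxE mulr_suml.
Qed.

(** * The derivative of the metric and the canonical connection *)

Section MetricDerivative.
Context (R : realType) (n : nat) (M : manifold R n).
Notation MA := (mfd_atlas M).
Notation TMA := (tangent_atlas MA).
Notation TM := (M * components MA)%type.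
Notation E := ('rV[R]_n * 'rV[R]_n)%type.
Notation index := (chart_index TMA).
Notation HTMA := (tangent_diff_atlas M).
Implicit Types (c d : index) (z : E).
Variables (S : TM -> components TMA) (g : index -> E -> 'M[R]_n).
Hypothesis HS : semispray S.
Hypothesis Hg : generalized_lagrange_metric g.

Lemma metric_smooth c : smooth_mx (chart_img (A := TMA) c) (g c).
Proof. by have [[sg _] _ _] := Hg; exact: sg. Qed.

Lemma metric_sym c z : chart_img (A := TMA) c z -> (g c z)^T = g c z.
Proof.
by move=> Iz; apply/matrixP => i j; rewrite mxE; have [_ sg _] := Hg; exact: sg.
Qed.

Lemma metric_unit c z : chart_img (A := TMA) c z -> g c z \in unitmx.
Proof.
by move=> Iz; have [_ _ rg] := Hg; rewrite -row_free_unit /row_free rg.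
Qed.

Lemma dxdxE c d z i k : dxdx c d z i k = base_jac c d z k i.
Proof. by []. Qed.

Lemma metric_change c d z : overlap (A := TMA) c d z ->
  g c z = base_jac c d z *m g d (coord_change c d z) *m (base_jac c d z)^T.
Proof.
move=> oz; have [[_ tg] _ _] := Hg; apply/matrixP => i j.
rewrite (tg _ _ _ oz) mulmx_trE; apply: eq_bigr => k _; apply: eq_bigr => l _.
by rewrite !dxdxE mulrAC.
Qed.

Definition lie_mx c z : 'M[R]_n :=
  \matrix_(i, j) lie_deriv S c (fun z' => g c z' i j) z.

Lemma is_diff_base_jac c d z i k : overlap (A := TMA) c d z ->
  is_diff z (fun z' => base_jac c d z' i k)
    (fun w => (change_hess c d z.1 (ebasis R i) w.1) 0 k).
Proof.
move=> oz; have oz1 := (tangent_overlapE c d z).1 oz.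
have d2 := differentiableP (base_change_diff2 (ebasis R i) oz1).
have D := is_diff_coord k (is_diff_comp (is_diff_fst z) d2).
rewrite [X in is_diff _ X](_ : _ =
  fun z' : E => ('d (base_change c d) (z'.1) (ebasis R i)) 0 k) //.
apply/funext => z'.
rewrite -[RHS](congr1 (fun v : 'rV[R]_n => v 0 k) (esym (diff_jacobian _ _ _))).
by rewrite -rowE [RHS]mxE.
Qed.

(** The Leibniz rule for [metric_change]. As the first components of [S] are the
    [y^i], the derivative of the Jacobian matrix along [S] is [base_hess], by
    symmetry of the second derivatives. *)
Lemma lie_mx_change c d z : overlap (A := TMA) c d z ->
  let P := base_jac c d z in let h := base_hess c d z in
  let g' := g d (coord_change c d z) in
  lie_mx c z = h *m g' *m P^T + P *m lie_mx d (coord_change c d z) *m P^T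
               + P *m g' *m h^T.
Proof.
move=> oz P h g'; have oz1 := (tangent_overlapE c d z).1 oz.
have Iz' := overlap_img_transition oz; have Iz := overlap_img oz.
apply/matrixP => i j; rewrite mxE /lie_deriv.
pose w := S (chart_inv (a := TMA) c z) c.
have hE a k : (change_hess c d z.1 (ebasis R a) w.1) 0 k = h a k.
  rewrite (semispray_fst HS Iz).
  apply: (etrans (congr1 (fun v : 'rV[R]_n => v 0 k) (change_hessC _ _ oz1))).
  apply: (etrans (congr1 (fun v : 'rV[R]_n => v 0 k) (change_hessE _ _ _ _))).
  by rewrite -rowE mxE.
have dcc := diff_transition HTMA oz.
have dg k l : differentiable (fun z' => g d z' k l) (coord_change c d z).
  exact: smooth_on_diff (@metric_smooth d k l) _ Iz'.
pose F (z' : E) := \sum_k \sum_l base_jac c d z' i k * base_jac c d z' j l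
                       * g d (coord_change c d z') k l.
have DF := is_diff_sum (index_enum 'I_n) (fun k => is_diff_sum (index_enum 'I_n)
  (fun l => is_diffM (is_diffM (is_diff_base_jac i k oz) (is_diff_base_jac j l oz))
     (is_diff_comp (differentiableP dcc) (differentiableP (dg k l))))).
have E1 : 'd (fun z' => g c z' i j) z w = 'd F z w.
  have [dF _] := DF; apply: near_eq_diff; last exact: dF.
  apply: (open_near (@tangent_overlap_open _ _ _ c d) oz) => y oy.
  rewrite (metric_change oy) mulmx_trE; apply: eq_bigr => k _; apply: eq_bigr => l _.
  by rewrite mulrAC.
have [_ /(congr1 (fun L => L w)) E2] := DF.
apply: (etrans E1); apply: (etrans E2).
have aux (A B C : 'M[R]_n) : (A + B + C) i j = A i j + B i j + C i j by rewrite !mxE.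
apply: (etrans _ (esym (aux _ _ _))).
apply: (etrans _ (esym (f_equal2 +%R (f_equal2 +%R (mulmx_trE _ _ _ _ _)
  (mulmx_trE _ _ _ _ _)) (mulmx_trE _ _ _ _ _)))).
rewrite -!big_split; apply: eq_bigr => k _.
rewrite -!big_split; apply: eq_bigr => l _.
have E4 : 'd (fun z' => g d z' k l) (coord_change c d z)
    ('d (transition (A := TMA) c d) z w) = lie_mx d (coord_change c d z) k l.
  by rewrite mxE /lie_deriv (semispray_change HS oz).
apply: (etrans (f_equal2 +%R (f_equal (fun t => P i k * P j l * t) E4)
  (f_equal (fun t => g' k l * t)
     (f_equal2 +%R (f_equal (fun t => P i k * t) (hE j l))
                   (f_equal (fun t => P j l * t) (hE i k)))))).
have ringE (p q G a b L : R) :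
    p * q * L + G * (p * b + q * a) = a * G * q + p * L * q + p * G * b by ring.
exact: ringE.
Qed.

Lemma lie_mx_smooth c : smooth_mx (chart_img (A := TMA) c) (lie_mx c).
Proof.
have oI := @chart_img_open _ _ _ _ HTMA c; have [[_ /(_ c) sS] _] := HS.
move=> i j k; have C := smooth_on_dirderiv oI (@metric_smooth c i j) sS k.
by apply: Ck_on_congr C => // z _; rewrite mxE.
Qed.

Lemma spray_jac_smooth c : smooth_mx (chart_img (A := TMA) c) (spray_jac S c).
Proof.
have oI := @chart_img_open _ _ _ _ HTMA c.
move=> i j k; have C := smooth_on_deriv (0, ebasis R i) (spray_coef_smooth HS c j) k.
by apply: Ck_on_congr C => // z _; rewrite mxE.
Qed.

Definition canonical_mx c z : 'M[R]_n :=
  canonical_of (g c z) (lie_mx c z) (spray_jac S c z).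

Lemma canonical_coefE c z i j : canonical_coef S g c z i j = canonical_mx c z i j.
Proof.
rewrite /canonical_coef /canonical_mx /canonical_of.
have aux (A B C : 'M[R]_n) :
    (2^-1 *: (A + B - C)) i j = 2^-1 * A i j + 2^-1 * (B i j - C i j).
  by rewrite !mxE -mulrDr addrA.
rewrite aux; congr (_ + _).
  by rewrite mxE; congr (_ * _); apply: eq_bigr => k _; rewrite mxE.
rewrite -[X in _ *m X]trmxK mulmx_trE mxE.
under eq_bigr => k _.
  under eq_bigr => s _ do rewrite /obata -mulrA mulrBl.
  rewrite -mulr_sumr; over.
rewrite -mulr_sumr; congr (_ * _).
under eq_bigr do rewrite big_split /= sumrN.
rewrite big_split /= sumrN; congr (_ - _).
  rewrite (bigD1 j) //= [X in _ + X]big1 => [|k kj]; last first.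
    by rewrite big1 // => s _; rewrite (negbTE kj) mulr0 mul0r.
  rewrite addr0 (bigD1 i) //= [X in _ + X]big1 => [|s si]; last first.
    by rewrite eq_sym (negbTE si) !mul0r.
  by rewrite !eqxx !mul1r addr0 mxE.
apply: eq_bigr => k _; apply: eq_bigr => s _.
by rewrite !mxE mulrAC.
Qed.

Lemma obata_sumE c z (X : 'M[R]_n) i j :
  \sum_k \sum_m obata g c z k i j m * X m k =
  obata_of (g c z) X i j.
Proof.
rewrite /obata_of.
under eq_bigr => k _.
  under eq_bigr => s _ do rewrite /obata -mulrA mulrBl.
  rewrite -mulr_sumr; over.
rewrite -mulr_sumr.
have aux (A B : 'M[R]_n) : (2^-1 *: (A - B)) i j = 2^-1 * (A i j - B i j).
  by rewrite !mxE.
rewrite aux mulmx_trE; congr (_ * _).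
under eq_bigr do rewrite big_split /= sumrN.
rewrite big_split /= sumrN; congr (_ - _).
  rewrite (bigD1 j) //= [X in _ + X]big1 => [|k kj]; last first.
    by rewrite big1 // => s _; rewrite (negbTE kj) !mul0r.
  rewrite addr0 (bigD1 i) //= [X in _ + X]big1 => [|s si]; last first.
    by rewrite eq_sym (negbTE si) mulr0 mul0r.
  by rewrite !eqxx !mul1r addr0.
by apply: eq_bigr => k _; apply: eq_bigr => s _; rewrite !mxE mulrAC.
Qed.

Lemma canonical_mx_smooth c :
  smooth_mx (chart_img (A := TMA) c) (canonical_mx c).
Proof.
have oI := @chart_img_open _ _ _ _ HTMA c.
have sg := @metric_smooth c.
have sV := smooth_invmx oI (@metric_unit c) sg.
have sL := @lie_mx_smooth c; have sJ := @spray_jac_smooth c.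
apply: (smooth_mxZ oI); apply: (smooth_mxD oI).
  by apply: (smooth_mxD oI); [exact: smooth_mxM|exact: smooth_mx_tr].
by apply: (smooth_mxN oI); apply: (smooth_mxM oI) => //; exact: smooth_mxM.
Qed.

End MetricDerivative.

(** * Metric connections *)

Section MetricConnections.
Context (R : realType) (n : nat) (M : manifold R n).
Notation MA := (mfd_atlas M).
Notation TMA := (tangent_atlas MA).
Notation TM := (M * components MA)%type.
Notation E := ('rV[R]_n * 'rV[R]_n)%type.
Notation index := (chart_index TMA).
Notation HTMA := (tangent_diff_atlas M).
Implicit Types (c d : index) (z : E).
Variables (S : TM -> components TMA) (g : index -> E -> 'M[R]_n).
Hypothesis HS : semispray S.
Hypothesis Hg : generalized_lagrange_metric g.

Lemma lie_mx_sym c z : chart_img (A := TMA) c z ->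
  (lie_mx S g c z)^T = lie_mx S g c z.
Proof.
move=> Iz; apply/matrixP => i j; rewrite !mxE /lie_deriv.
have oI := @chart_img_open _ _ _ _ HTMA c.
apply: near_eq_diff; last exact: smooth_on_diff (@metric_smooth _ _ _ _ Hg c i j) _ Iz.
by apply: (open_near oI Iz) => y Iy; have [_ + _] := Hg; apply.
Qed.

Lemma canonical_connection_family :
  connection_family (fun c z => (canonical_mx S g c z)^T).
Proof.
split=> [c|c d z oz].
  have oI := @chart_img_open _ _ _ _ HTMA c.
  by apply: (smooth_mx_tr oI); exact: (@canonical_mx_smooth _ _ _ _ _ HS Hg c).
have Iz := overlap_img oz; have Iz' := overlap_img_transition oz.
exact: canonical_of_change (metric_unit Hg Iz) (metric_unit Hg Iz') (base_jacVK oz)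
  (metric_change Hg oz) (lie_mx_change HS Hg oz) (spray_jac_change HS oz).
Qed.

Lemma dtensor11P (X : index -> E -> 'M[R]_n) : dtensor11 X <->
  (forall c, smooth_mx (chart_img (A := TMA) c) (X c)) /\
  (forall c d z, overlap (A := TMA) c d z ->
     X d (coord_change c d z) = (base_jac c d z)^T *m X c z
       *m (base_jac d c (coord_change c d z))^T).
Proof.
have aux c d z i j : \sum_k \sum_l dxdx c d z i k *
    dxdx d c (coord_change c d z) l j * X c z k l =
    ((base_jac c d z)^T *m X c z *m (base_jac d c (coord_change c d z))^T) i j.
  rewrite mulmx_trE; apply: eq_bigr => k _; apply: eq_bigr => l _.
  by rewrite !dxdxE [RHS]mulrAC; congr (_ * _ * _); rewrite [RHS]mxE.
split=> -[sX tX]; split=> // c d z oz; last by move=> i j; rewrite aux tX.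
by apply/matrixP => i j; rewrite (tX _ _ _ oz) aux.
Qed.

Lemma connection_familyD b (X : index -> E -> 'M[R]_n) :
  connection_family b -> dtensor11 X ->
  connection_family (fun c z => b c z + (X c z)^T).
Proof.
move=> [sb tb] /dtensor11P[sX tX]; split=> [c|c d z oz].
  have oI := @chart_img_open _ _ _ _ HTMA c.
  by apply: (smooth_mxD oI); [exact: sb|exact: smooth_mx_tr].
exact: change_addmx (base_jacK oz) (tb _ _ _ oz) (tX _ _ _ oz).
Qed.

Lemma connection_familyB b b' : connection_family b -> connection_family b' ->
  dtensor11 (M := M) (fun c z => (b c z - b' c z)^T).
Proof.
move=> [sb tb] [sb' tb']; apply/dtensor11P; split=> [c|c d z oz].
  have oI := @chart_img_open _ _ _ _ HTMA c.
  apply: (smooth_mx_tr oI); apply: (smooth_mxD oI); first exact: sb.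
  exact: (smooth_mxN oI).
exact: change_submx (base_jacVK oz) (tb _ _ _ oz) (tb' _ _ _ oz).
Qed.

Lemma obata_dtensor (X : index -> E -> 'M[R]_n) : dtensor11 X ->
  dtensor11 (fun c z => obata_of (g c z) (X c z)).
Proof.
move=> /dtensor11P[sX tX]; apply/dtensor11P; split=> [c|c d z oz].
  have oI := @chart_img_open _ _ _ _ HTMA c; have sg := @metric_smooth _ _ _ _ Hg c.
  have sV := smooth_invmx oI (@metric_unit _ _ _ _ Hg c) sg.
  apply: (smooth_mxZ oI); apply: (smooth_mxD oI); first exact: sX.
  apply: (smooth_mxN oI); apply: (smooth_mxM oI); last exact: smooth_mx_tr.
  by apply: (smooth_mxM oI); apply: (smooth_mx_tr oI) => //; exact: sX.
have Iz := overlap_img oz; have Iz' := overlap_img_transition oz.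
apply: (change_trmx (base_jacVK oz)).
exact: obata_of_change (metric_sym Hg Iz) (metric_sym Hg Iz') (metric_unit Hg Iz)
  (metric_unit Hg Iz') (base_jacVK oz) (metric_change Hg oz) (tX c d z oz).
Qed.

Lemma family_coefE (X : index -> E -> 'M[R]_n) c z i j :
  family_coef S g X c z i j =
  ((canonical_mx S g c z)^T + (obata_of (g c z) (X c z))^T) j i.
Proof.
rewrite /family_coef canonical_coefE obata_sumE.
have aux (A B : 'M[R]_n) : (A^T + B^T) j i = A i j + B i j by rewrite !mxE.
by rewrite aux.
Qed.

Lemma nabla_metricE N c (X Y : E -> 'rV[R]_n) z : chart_img (A := TMA) c z ->
  differentiable X z -> differentiable Y z ->
  nabla_metric S N g c X Y z =
  (X z *m (lie_mx S g c z - conn_mx N c z *m g c z - g c z *m (conn_mx N c z)^T)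
     *m (Y z)^T) 0 0.
Proof.
move=> Iz dX dY; pose w := S (chart_inv (a := TMA) c z) c.
have dg i j : differentiable (fun y => g c y i j) z.
  exact: smooth_on_diff (@metric_smooth _ _ _ _ Hg c i j) _ Iz.
have D := is_diff_sum (index_enum 'I_n) (fun i => is_diff_sum (index_enum 'I_n)
  (fun j => is_diffM (is_diffM (differentiableP (dg i j))
     (is_diff_coord i (differentiableP dX))) (is_diff_coord j (differentiableP dY)))).
have [_ /(congr1 (fun F => F w)) E1] := D.
pose G := g c z; pose B := conn_mx N c z; pose L := lie_mx S g c z.
pose x := X z; pose y := Y z; pose xi := 'd X z w; pose eta := 'd Y z w.
have vE X' Y' : vpair g c X' Y' z = (X' z *m G *m (Y' z)^T) 0 0.
  rewrite mulmx_trE; apply: eq_bigr => i _; apply: eq_bigr => j _.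
  by rewrite (mulrC (X' z 0 i)).
have nE Z : differentiable Z z -> nabla S N c Z z = 'd Z z w + Z z *m B.
  move=> dZ; apply/rowP => i; rewrite [LHS]mxE [RHS]mxE; congr (_ + _).
    by have [_ E2] := diff_coord w i dZ; exact: E2.
  by rewrite [RHS]mxE; apply: eq_bigr => j _; congr (_ * _); rewrite mxE.
have lE : lie_deriv S c (vpair g c X Y) z =
    (x *m G *m eta^T + xi *m G *m y^T + x *m L *m y^T) 0 0.
  have aux (A1 A2 A3 : 'M[R]_1) : (A1 + A2 + A3) 0 0 = A1 0 0 + A2 0 0 + A3 0 0.
    by rewrite !mxE.
  apply: (etrans E1); rewrite aux !mulmx_trE -!big_split; apply: eq_bigr => i _.
  rewrite -!big_split; apply: eq_bigr => j _ /=.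
  have ringE (a p q r s l : R) : a * p * q + r * (a * s + p * l) =
    p * a * q + s * a * r + p * l * r by ring.
  apply: etrans (ringE _ _ _ _ _ _) _; congr (_ + _ * _ * _).
  by rewrite mxE.
rewrite /nabla_metric lE.
rewrite (vE (nabla S N c X) Y) (vE X (nabla S N c Y)).
rewrite (nE X dX) (nE Y dY).
exact: connection_defect.
Qed.

(** [nabla g] is tensorial, so its vanishing is tested on the constant fields. *)
Lemma metric_connectionP N : metric_connection S g N <->
  forall c z, chart_img (A := TMA) c z ->
    conn_mx N c z *m g c z + g c z *m (conn_mx N c z)^T = lie_mx S g c z.
Proof.
split=> [mN c z Iz|mN c X Y sX sY z Iz].
  apply/esym/eqP; rewrite -subr_eq0 opprD addrA; apply/eqP/matrixP => i j.
  have oI := @chart_img_open _ _ _ _ HTMA c.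
  have sC v : smooth_on (chart_img (A := TMA) c) (cst v : E -> 'rV[R]_n).
    by move=> k; exact: Ck_on_cst.
  have := mN c _ _ (sC (ebasis R i)) (sC (ebasis R j)) z Iz.
  rewrite nabla_metricE //; try exact: differentiable_cst.
  by rewrite /cst /ebasis trmx_delta -rowE -colE !mxE.
have dX := smooth_on_diff sX Iz; have dY := smooth_on_diff sY Iz.
rewrite nabla_metricE //.
by rewrite -(mN c z Iz) addrAC addrK subrr mulmx0 mul0mx mxE.
Qed.

End MetricConnections.

Theorem theorem2p4 (R : realType) (n : nat) (M : manifold R n)
    (S : M * components (mfd_atlas M) ->
         components (tangent_atlas (mfd_atlas M)))
    (g : chart_index (tangent_atlas (mfd_atlas M)) ->
         'rV[R]_n * 'rV[R]_n -> 'M[R]_n) :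
  semispray S ->
  generalized_lagrange_metric g ->
  (forall X, dtensor11 X ->
     exists N, nonlinear_connection N /\ has_coef N (family_coef S g X)) /\
  (forall N, nonlinear_connection N ->
     (metric_connection S g N <->
      exists X, dtensor11 X /\ has_coef N (family_coef S g X))).
Proof.
move=> HS Hg; have Hc := canonical_connection_family HS Hg; split=> [X tX|N HN].
  have Hb := connection_familyD Hc (obata_dtensor Hg tX).
  exists (horizontal_space (fun c z => (canonical_mx S g c z)^T
                                       + (obata_of (g c z) (X c z))^T)).
  split; first exact: family_nonlinear_connection.
  move=> c z Iz i j; rewrite family_coefE -(family_conn_mx Hb Iz).
  by rewrite [RHS]mxE.
have HB := nonlinear_connection_family HN.
(* [N^c] is a solution of the affine equation of metric connections, so [N] is
   one iff the difference [N - N^c] solves the linear equation. *)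
have metric_of c z (B : 'M[R]_n) : chart_img (A := tangent_atlas (mfd_atlas M)) c z ->
    (B *m g c z + g c z *m B^T = lie_mx S g c z) <->
    (B^T - canonical_mx S g c z)^T *m g c z
     + g c z *m (B^T - canonical_mx S g c z) = 0.
  move=> Iz.
  have {1}<- := canonical_of_metric (spray_jac S c z) (metric_unit Hg Iz)
    (metric_sym Hg Iz) (lie_mx_sym S Hg Iz).
  rewrite linearB /= trmxK mulmxBl mulmxBr addrACA -opprD.
  by split=> [->|/eqP]; [exact: subrr|rewrite subr_eq0 => /eqP].
split=> [/(metric_connectionP S Hg) mN|[X [tX NX]]].
  exists (fun c z => (conn_mx N c z)^T - canonical_mx S g c z); split.
    have := connection_familyB HB Hc.
    congr dtensor11; apply/funext => c; apply/funext => z.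
    by rewrite linearB /= trmxK.
  move=> c z Iz i j; rewrite family_coefE.
  have /metric_of-/(_ Iz) E0 := mN c z Iz.
  rewrite (obata_of_fixed (metric_unit Hg Iz) (metric_sym Hg Iz) E0).
  by rewrite -linearD /= addrC subrK trmxK mxE.
apply/(metric_connectionP S Hg) => c z Iz; apply/(metric_of _ _ _ Iz).
have -> : conn_mx N c z = (canonical_mx S g c z)^T + (obata_of (g c z) (X c z))^T.
  by apply/matrixP => j i; rewrite mxE (NX c z Iz) family_coefE.
rewrite -linearD /= trmxK [canonical_mx _ _ _ _ + _]addrC addrK.
exact: obata_of_metric (metric_unit Hg Iz) (metric_sym Hg Iz).
Qed.
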